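(* Let $S_{\boldsymbol{\lambda}}$ be a densely defined weighted shift on a directed tree $\mathfrak{T}=(V,E)$ with weights $\boldsymbol{\lambda}:V^\circ\to\mathbb{C}$ and let $t\in(0,1]$. Define $\boldsymbol{\mu}=\{\mu_v\}_{v\in V^\circ}$ by $$\mu_v=\begin{cases}\dfrac{\|S_{\boldsymbol{\lambda}}e_v\|^t}{\|S_{\boldsymbol{\lambda}}e_{\mathrm{par}(v)}\|^t}\,\lambda_v,&\text{if }\mathrm{par}(v)\in V_{\boldsymbol{\lambda}}^+,\\ 0,&\text{otherwise},\end{cases}\qquad v\in V^\circ.$$ Then: (i) $\mathcal{D}(\Delta_t(S_{\boldsymbol{\lambda}}))=\mathcal{D}(S_{\boldsymbol{\mu}})\cap\mathcal{D}(|S_{\boldsymbol{\lambda}}|^{1-t})$; (ii) $\Delta_t(S_{\boldsymbol{\lambda}})$ is closable and $\overline{\Delta_t(S_{\boldsymbol{\lambda}})}=S_{\boldsymbol{\mu}}$.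
   Context: A directed tree $\mathfrak{T}=(V,E)$ is a connected directed graph (nonempty vertex set $V$, edge set $E$) without circuits in which every vertex $v$ has at most one parent, i.e. at most one $u\in V$ with $(u,v)\in E$. If it has a root (the unique vertex with no parent), it is denoted $\mathrm{root}$ and $V^\circ=V\setminus\{\mathrm{root}\}$; otherwise $V^\circ=V$. For $u\in V$, $\mathrm{Chi}(u)=\{v\in V:(u,v)\in E\}$; for $v\in V^\circ$, $\mathrm{par}(v)$ is the unique $u$ with $v\in\mathrm{Chi}(u)$. $\ell^2(V)$ is the complex Hilbert space of square-summable functions $f:V\to\mathbb{C}$, with orthonormal basis $\{e_u\}_{u\in V}$ ($e_u(v)=1$ if $u=v$, and $0$ otherwise). For any system of weights $\boldsymbol{\lambda}=\{\lambda_v\}_{v\in V^\circ}\subseteq\mathbb{C}$ (and likewise for $\boldsymbol{\mu}$), the weighted shift $S_{\boldsymbol{\lambda}}$ is the operator in $\ell^2(V)$ with domain $$\mathcal{D}(S_{\boldsymbol{\lambda}})=\Big\{f\in\ell^2(V):\sum_{u\in V}\Big(\sum_{v\in\mathrm{Chi}(u)}|\lambda_v|^2\Big)|f(u)|^2<\infty\Big\}$$ (with $\infty\cdot 0=0$) and $(S_{\boldsymbol{\lambda}}f)(v)=\lambda_v f(\mathrm{par}(v))$ for $v\in V^\circ$, $(S_{\boldsymbol{\lambda}}f)(\mathrm{root})=0$ (if there is a root). It is always closed, and it is densely defined if and only if every $e_u$ lies in $\mathcal{D}(S_{\boldsymbol{\lambda}})$. $V_{\boldsymbol{\lambda}}^+=\{u\in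 V:S_{\boldsymbol{\lambda}}e_u\neq0\}$. For a closed densely defined operator $T$ in a Hilbert space with polar decomposition $T=U|T|$ ($|T|=(T^*T)^{1/2}$, $U$ a partial isometry with kernel $\mathcal{N}(T)$) and $t\in(0,1]$, the $t$-Aluthge transform is $\Delta_t(T)=|T|^tU|T|^{1-t}$ with the natural domain of the composition; $|T|^0=I$ is the identity on the whole space. An operator is closable if the closure of its graph is the graph of an operator, which is then its closure $\overline{T}$. *)

(* Defs.v *)
From HB Require Import structures.
From mathcomp Require Import all_boot all_order all_algebra.
From mathcomp Require Import all_classical all_reals all_analysis.
From mathcomp Require Import complex.

Set Implicit Arguments.
Unset Strict Implicit.
Unset Printing Implicit Defensive.

Import Order.TTheory GRing.Theory Num.Theory.

Local Open Scope classical_set_scope.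
Local Open Scope ring_scope.
Local Open Scope complex_scope.

(** * Directed trees *)

(* The edge relation is boolean, which classically loses no generality.
   The circuits excluded are the simple directed cycles, loops included. *)
Record directed_tree (V : eqType) (E : rel V) : Prop := DirectedTree {
  tree_nonempty : inhabited V;
  tree_connected : forall u v : V, exists p : seq V,
    path (fun x y => E x y || E y x) u p /\ last u p = v;
  tree_acyclic : forall c : seq V, c <> [::] -> ~ ucycle E c;
  tree_parent : forall u u' v : V, E u v -> E u' v -> u = u' }.

Section Tree.
Context {V : choiceType}.
Variable E : rel V.

Definition nonroot : set V := [set v | exists u, E u v].

Definition chi (u : V) : set V := [set v | E u v].

(* For v outside [nonroot] the value is v, which is never used. *)
Definition par (v : V) : V := xget v [set u | E u v].

End Tree.

(** * The Hilbert space l^2(V) *)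

Section Ell2.
Context {R : realType} {V : choiceType}.
Implicit Types f g : V -> R[i].

Definition sqsum f : \bar R := \esum_(v in [set: V]) ((Normc.normc (f v)) ^+ 2)%:E.

Definition ell2 : set (V -> R[i]) := [set f | (sqsum f < +oo)%E].

Definition norm2 f : R := Num.sqrt (fine (sqsum f)).

(* Unordered sums of absolutely summable real, resp. complex, families. *)
Definition rsum (x : V -> R) : R :=
  fine (\esum_(v in [set: V]) (EFin \o x)^\+ v
        - \esum_(v in [set: V]) (EFin \o x)^\- v)%E.

Definition csum (z : V -> R[i]) : R[i] :=
  rsum (fun v => complex.Re (z v)) +i* rsum (fun v => complex.Im (z v)).

(* Linear in the first argument. *)
Definition inner f g : R[i] := csum (fun v => f v * (g v)^*).

Definition lincomb (a : R[i]) f g : V -> R[i] := fun v => a * f v + g v.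

Definition vzero : V -> R[i] := fun=> 0.

Definition ebasis (u : V) : V -> R[i] := fun v => (v == u)%:R.

End Ell2.

(** * Unbounded operators, identified with their graphs *)

Notation op R V := (set ((V -> R[i]) * (V -> R[i]))).

Section Operators.
Context {R : realType} {V : choiceType}.
Implicit Types (f g h k : V -> R[i]) (T A U : op R V).

Definition dom T : set (V -> R[i]) := [set f | exists g, T (f, g)].

Definition linear_operator T : Prop :=
  [/\ forall f g, T (f, g) -> ell2 f /\ ell2 g,
      T (vzero, vzero),
      forall a f g f' g', T (f, g) -> T (f', g') ->
        T (lincomb a f f', lincomb a g g')
    & forall f g g', T (f, g) -> T (f, g') -> g = g'].

Definition densely_defined T : Prop :=
  forall f, ell2 f -> forall e : R, 0 < e ->
    exists2 g, dom T g & norm2 (lincomb (-1) g f) < e.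

(* [comp A T] is "first T, then A", on its natural domain. *)
Definition comp A T : op R V :=
  [set fh | exists2 g, T (fh.1, g) & A (g, fh.2)].

(* Closure of the graph in l^2(V) x l^2(V). *)
Definition closure_op T : op R V :=
  [set fg | [/\ ell2 fg.1, ell2 fg.2 & forall e : R, 0 < e ->
     exists fg', [/\ T fg', norm2 (lincomb (-1) fg'.1 fg.1) < e
                   & norm2 (lincomb (-1) fg'.2 fg.2) < e]]].

Definition closable T : Prop := linear_operator (closure_op T).

Definition adjoint T : op R V :=
  [set gh | [/\ ell2 gh.1, ell2 gh.2 &
     forall f k, T (f, k) -> inner k gh.1 = inner f gh.2]].

Definition kernel T : set (V -> R[i]) := [set f | T (f, vzero)].

Definition orthocomplement (N : set (V -> R[i])) : set (V -> R[i]) :=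
  [set f | ell2 f /\ forall g, N g -> inner f g = 0].

Definition partial_isometry U : Prop :=
  [/\ linear_operator U, dom U = ell2,
      exists c : R, forall f g, U (f, g) -> norm2 g <= c * norm2 f
    & forall f g, orthocomplement (kernel U) f -> U (f, g) ->
        norm2 g = norm2 f].

(** ** Spectral measures and the Borel functional calculus *)

Definition orthogonal_projection (P : (V -> R[i]) -> (V -> R[i])) : Prop :=
  [/\ forall f, ell2 f -> ell2 (P f),
      forall a f g, ell2 f -> ell2 g ->
        P (lincomb a f g) = lincomb a (P f) (P g),
      forall f, ell2 f -> P (P f) = P f
    & forall f g, ell2 f -> ell2 g -> inner (P f) g = inner f (P g)].

(* The countable additivity of a spectral measure is expressed by [smeas]:
   for every f in l^2(V), B |-> <P(B)f, f> is a measure on the Borel sets. *)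
Record spectral_measure := SpectralMeasure {
  sproj : set R -> (V -> R[i]) -> (V -> R[i]);
  smeas : (V -> R[i]) -> {measure set (measurableTypeR R) -> \bar R};
  sproj_orth : forall B : set (measurableTypeR R), measurable B ->
    orthogonal_projection (sproj B);
  sproj_setT : forall f, ell2 f -> sproj setT f = f;
  smeasE : forall f (B : set (measurableTypeR R)), ell2 f -> measurable B ->
    smeas f B = (complex.Re (inner (sproj B f) f))%:E }.

Implicit Types (P : spectral_measure) (phi : R -> R).

Definition spectral_dom P phi : set (V -> R[i]) :=
  [set f | ell2 f /\
    (\int[smeas P f]_(x in [set: measurableTypeR R]) ((phi x) ^+ 2)%:E
       < +oo)%E].

(* The integral of phi against the complex measure B |-> <P(B)f, h>, which by
   polarization is 1/4 \sum_(k < 4) i^k <P(.)(f + i^k h), f + i^k h>. *)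
Definition polarized_integral P phi f h : R[i] :=
  4^-1 * \sum_(k < 4) 'i%C ^+ k *
    (Rintegral (smeas P (lincomb ('i%C ^+ k) h f)) [set: measurableTypeR R]
       phi)%:C.

(* The operator \int phi dP : for f in its (dense) domain it has the value g
   determined by <g, h> = \int phi d<P(.)f, h>. *)
Definition spectral_integral P phi : op R V :=
  [set fg | [/\ spectral_dom P phi fg.1, ell2 fg.2 &
     forall h, spectral_dom P phi h ->
       inner fg.2 h = polarized_integral P phi fg.1 h]].

(* A^s for a positive selfadjoint A: the integral of x^s against the spectral
   measure of A, which exists and is unique by the spectral theorem. As
   0 `^ 0 = 1, A^0 is the identity on the whole space. *)
Definition op_pow A (s : R) : op R V :=
  [set fg | exists2 P : spectral_measure,
     spectral_integral P id = A
     & spectral_integral P (fun x => x `^ s) fg].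

Definition op_abs T : op R V := op_pow (comp (adjoint T) T) 2^-1.

(* T = U|T| is the polar decomposition of T. *)
Definition polar_factor T U : Prop :=
  [/\ partial_isometry U, kernel U = kernel T & T = comp U (op_abs T)].

(* |T|^t U |T|^(1-t) with U the unique polar factor of T. *)
Definition aluthge (t : R) T : op R V :=
  [set fg | exists2 U, polar_factor T U &
     comp (op_pow (op_abs T) t) (comp U (op_pow (op_abs T) (1 - t))) fg].

End Operators.

(** * Weighted shifts *)

(* A system of weights indexed by the non-root vertices is represented by a
   total function; its value at the root (if any) is never used. *)
Section WeightedShift.
Context {R : realType} {V : choiceType}.
Variable E : rel V.
Implicit Types lam : V -> R[i].

Definition wshift_fun lam (f : V -> R[i]) : V -> R[i] :=
  fun v => if v \in nonroot E then lam v * f (par E v) else 0.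

Definition wshift_dom lam : set (V -> R[i]) :=
  [set f | ell2 f /\
    (\esum_(u in [set: V])
       ((\esum_(v in chi E u) ((Normc.normc (lam v)) ^+ 2)%:E)
        * ((Normc.normc (f u)) ^+ 2)%:E) < +oo)%E].

Definition wshift lam : op R V :=
  [set fg | wshift_dom lam fg.1 /\ fg.2 = wshift_fun lam fg.1].

Definition Vplus lam : set V := [set u | wshift_fun lam (ebasis u) <> vzero].

Definition aluthge_weights (t : R) lam : V -> R[i] :=
  fun v => if par E v \in Vplus lam then
    (norm2 (wshift_fun lam (ebasis v)) `^ t
     / norm2 (wshift_fun lam (ebasis (par E v))) `^ t)%:C * lam v
  else 0.

End WeightedShift.

(* Main.v *)
Require Import Defs.
From mathcomp Require Import all_boot all_order all_algebra.
From mathcomp Require Import all_classical all_reals all_analysis.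
From mathcomp Require Import complex measurable_realfun ring lra.

(** Write a(u) for the norm of S e_u. Distinct vertices have disjoint sets of
children, so the vectors S e_u are pairwise orthogonal and S f has the same norm
as the pointwise product a f, for every f ([sqsum_wshift], [wshift_norm]). By
polarization S*S is multiplication by a^2 ([adjoint_wshift_comp]); hence |S| is
multiplication by a and |S|^s is multiplication by a^s. The polar factor sends
e_u to S e_u / a(u), or to 0 when a(u) = 0 ([polar_opP]), and a bounded operator
is determined by its values on the e_u ([polar_factor_unique]). So the vector
|S|^t U |S|^(1-t) f takes at a vertex v with parent u the value
a(v)^t lambda_v a(u)^(-t) f(u), which is mu_v f(u) ([aluthge_fun]).

The domain of a weighted shift consists of the square-summable f whose formal
image is square-summable ([wshiftP]), which gives the description of the domain
of the transform. It is therefore the restriction of S_mu to the domain of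
|S|^(1-t). Now S_mu is closed ([wshift_closed]), and truncating a vector of its
domain to finitely many vertices approximates it in the graph norm
([wshift_core]); truncated vectors lie in the domain of |S|^(1-t), so the closure
of the restriction is all of S_mu.

The powers of an operator A are taken with respect to some spectral measure P
such that A is the integral of x dP, and two facts are needed about
multiplication by a real function b. It has such a P, for which P(B) multiplies
by the indicator of B o b: the measure <P(.)f, f> is a countable sum of point
masses, and the integral of a measurable phi, nonnegative on the range of b, is
multiplication by phi o b ([spectral_integralE]). And there is no other P: the
identity A e_u = b(u) e_u, tested against P(B)e_u, says that x has mean b(u) over
every Borel set B for the measure <P(.)e_u, e_u>, which is thus a point mass at
b(u) ([multiplication_measure_unique]). *)

Set Implicit Arguments.
Unset Strict Implicit.
Unset Printing Implicit Defensive.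

Import Order.TTheory GRing.Theory Num.Theory.

Local Open Scope classical_set_scope.
Local Open Scope ring_scope.
Local Open Scope complex_scope.

Local Notation nrm := Normc.normc.
Local Notation cj z := (@Num.conj (complex _) z : complex _).

(** * Unordered sums *)

Section Esum.
Context {R : realType} {T : choiceType}.
Implicit Types (x y : T -> \bar R) (D : set T).

Lemma esumZl (c : R) D x : 0 <= c -> (forall v, (0 <= x v)%E) ->
  (\esum_(v in D) (c%:E * x v) = c%:E * \esum_(v in D) x v)%E.
Proof.
move=> c0 x0; rewrite /esum -ereal_supZl//.
  rewrite image_comp; congr (ereal_sup _); apply: eq_imagel => F _ /=.
  by rewrite ge0_mule_fsumr.
apply/set0P; exists (\sum_(v \in set0) x v)%E, set0 => //.
exact: fsets_set0.
Qed.

Lemma esum_ge_term D x v : (forall v, (0 <= x v)%E) -> D v ->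
  (x v <= \esum_(v in D) x v)%E.
Proof.
move=> x0 Dv; apply: esum_ge; exists [set v]; last by rewrite fsbig_set1.
by split; [exact: finite_set1|move=> _ ->].
Qed.

Lemma esum_eq0 D x v : (forall v, (0 <= x v)%E) ->
  (\esum_(v in D) x v = 0)%E -> D v -> x v = 0%E.
Proof.
move=> x0 s0 Dv; apply/eqP; rewrite eq_le x0 andbT -s0.
exact: esum_ge_term.
Qed.

Lemma le_esum_lty D x y : (forall v, D v -> (x v <= y v)%E) ->
  (\esum_(v in D) y v < +oo)%E -> (\esum_(v in D) x v < +oo)%E.
Proof. by move=> xy; apply: le_lt_trans; exact: le_esum. Qed.

Lemma esum_tail x (e : R) : (forall v, (0 <= x v)%E) ->
  (\esum_(v in setT) x v < +oo)%E -> 0 < e ->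
  exists2 F : set T, finite_set F & (\esum_(v in ~` F) x v < e%:E)%E.
Proof.
move=> x0 xoo e0.
have sfin : (\esum_(v in setT) x v)%E \is a fin_num.
  by rewrite ge0_fin_numE//; exact: esum_ge0.
have [_ [F [finF _] <-] lF] := ub_ereal_sup_adherent e0 sfin; exists F => //.
have sE : (\esum_(v in setT) x v = \sum_(v \in F) x v + \esum_(v in ~` F) x v)%E.
  by rewrite (esumID F)// !setTI esum_fset.
have Ffin : (\sum_(v \in F) x v)%E \is a fin_num.
  rewrite ge0_fin_numE; last by rewrite fsume_ge0.
  by apply: le_lt_trans xoo; rewrite sE leeDl// esum_ge0.
move: lF; rewrite -/(esum _ _) sE lteBlDr// lteD2lE//.
Qed.

End Esum.

Section RealSum.
Context {R : realType} {V : choiceType}.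
Implicit Types x y p n : V -> R.

Lemma esum_fin_num p : (forall v, 0 <= p v) ->
  (\esum_(v in setT) (p v)%:E < +oo)%E ->
  (\esum_(v in setT) (p v)%:E)%E \is a fin_num.
Proof.
by move=> p0; rewrite ge0_fin_numE//; apply: esum_ge0 => v _; rewrite lee_fin.
Qed.

Lemma rsum_ge0E p : (forall v, 0 <= p v) ->
  rsum p = fine (\esum_(v in setT) (p v)%:E).
Proof.
move=> p0; rewrite /rsum [X in (_ - X)%E](_ : _ = 0%E) ?sube0.
  congr fine; apply: eq_esum => v _.
  by rewrite (@ge0_funeposE _ _ setT) ?inE// => u _; rewrite lee_fin.
apply: esum1 => v _.
by rewrite (@ge0_funenegE _ _ setT) ?inE// => u _; rewrite lee_fin.
Qed.

(** The value does not depend on the way in which a family is split into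
nonnegative parts; linearity follows. *)
Lemma rsumB p n : (forall v, 0 <= p v) -> (forall v, 0 <= n v) ->
  (\esum_(v in setT) (p v)%:E < +oo)%E -> (\esum_(v in setT) (n v)%:E < +oo)%E ->
  rsum (fun v => p v - n v) = rsum p - rsum n.
Proof.
move=> p0 n0 poo noo; rewrite (rsum_ge0E p0) (rsum_ge0E n0) -fineB ?esum_fin_num//.
rewrite /rsum; congr fine; apply: (@esumB _ _ _ (EFin \o p) (EFin \o n)).
- by rewrite /summable (eq_esum (b := EFin \o p))// => v _ /=; rewrite ger0_norm.
- by rewrite /summable (eq_esum (b := EFin \o n))// => v _ /=; rewrite ger0_norm.
- by move=> v _; rewrite lee_fin.
- by move=> v _; rewrite lee_fin.
Qed.

Definition rsummable x := (\esum_(v in setT) (`|x v|)%:E < +oo)%E.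

Lemma rsummable_le x y : (forall v, `|x v| <= y v) ->
  (\esum_(v in setT) (y v)%:E < +oo)%E -> rsummable x.
Proof. by move=> xy; apply: le_esum_lty => v _; rewrite lee_fin. Qed.

(** The splitting x = (|x| + x) - |x| spares a discussion of signs. *)
Lemma rsum_posneg x : rsummable x ->
  exists p n, [/\ forall v, 0 <= p v, forall v, 0 <= n v,
    (\esum_(v in setT) (p v)%:E < +oo)%E, (\esum_(v in setT) (n v)%:E < +oo)%E
    & forall v, x v = p v - n v].
Proof.
move=> xoo; exists (fun v => `|x v| + x v), (fun v => `|x v|); split => [v|v|||v].
- by have := ler_norm (- x v); rewrite normrN; lra.
- exact: normr_ge0.
- apply: (@le_esum_lty _ _ _ _ (fun v => 2%:E * (`|x v|)%:E)%E).
    by move=> v _; rewrite lee_fin mulr2n mulrDl mul1r lerD2l ler_norm.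
  by rewrite esumZl// ?lte_mul_pinfty// esum_ge0// => v _; rewrite lee_fin.
- exact: xoo.
- by rewrite addrAC subrr add0r.
Qed.

Lemma rsum_ge0D p n : (forall v, 0 <= p v) -> (forall v, 0 <= n v) ->
  (\esum_(v in setT) (p v)%:E < +oo)%E -> (\esum_(v in setT) (n v)%:E < +oo)%E ->
  rsum (fun v => p v + n v) = rsum p + rsum n /\
  (\esum_(v in setT) (p v + n v)%:E < +oo)%E.
Proof.
move=> p0 n0 poo noo.
have pn0 v : 0 <= p v + n v by rewrite addr_ge0.
rewrite rsum_ge0E// !rsum_ge0E// -fineD ?esum_fin_num//.
have -> : (\esum_(v in setT) (p v + n v)%:E =
    \esum_(v in setT) (p v)%:E + \esum_(v in setT) (n v)%:E)%E.
  by rewrite -esumD// => v _; rewrite lee_fin.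
by split; rewrite // lte_add_pinfty.
Qed.

Lemma rsumD x y : rsummable x -> rsummable y ->
  rsum (fun v => x v + y v) = rsum x + rsum y.
Proof.
move=> /rsum_posneg[p [n [p0 n0 poo noo xE]]] /rsum_posneg[q [m [q0 m0 qoo moo yE]]].
have [pqD pqoo] := rsum_ge0D p0 q0 poo qoo.
have [nmD nmoo] := rsum_ge0D n0 m0 noo moo.
have -> : (fun v => x v + y v) = (fun v => (p v + q v) - (n v + m v)).
  by apply/funext => v; rewrite xE yE opprD addrACA.
rewrite rsumB//; [|by move=> v; rewrite addr_ge0..].
rewrite (funext xE) (funext yE) !rsumB// pqD nmD; ring.
Qed.

Lemma rsumN x : rsummable x -> rsum (fun v => - x v) = - rsum x.
Proof.
move=> /rsum_posneg[p [n [p0 n0 poo noo xE]]].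
have -> : (fun v => - x v) = (fun v => n v - p v).
  by apply/funext => v; rewrite xE opprB.
by rewrite (funext xE) !rsumB// opprB.
Qed.

Lemma rsumZ c x : rsummable x -> rsum (fun v => c * x v) = c * rsum x.
Proof.
wlog c0 : c / 0 <= c => [wlg xoo|].
  have [c0|c0] := leP 0 c; first exact: wlg.
  have oc0 : 0 <= - c by rewrite oppr_ge0 ltW.
  rewrite -[c in RHS]opprK mulNr -wlg// -rsumN; last first.
    apply: (@rsummable_le _ (fun v => (- c) * `|x v|)).
      by move=> v; rewrite normrM (ger0_norm oc0).
    under eq_esum do rewrite EFinM.
    by rewrite esumZl// ?lte_mul_pinfty// esum_ge0// => v _; rewrite lee_fin.
  by congr rsum; apply/funext => v; rewrite mulNr opprK.
move=> /rsum_posneg[p [n [p0 n0 poo noo xE]]].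
have Z (q : V -> R) : (forall v, 0 <= q v) -> (\esum_(v in setT) (q v)%:E < +oo)%E ->
    rsum (fun v => c * q v) = c * rsum q /\
    (\esum_(v in setT) (c * q v)%:E < +oo)%E.
  move=> q0 qoo.
  have cE : (\esum_(v in setT) (c * q v)%:E = c%:E * \esum_(v in setT) (q v)%:E)%E.
    by under eq_esum do rewrite EFinM; rewrite esumZl.
  rewrite !rsum_ge0E// ?cE; last by move=> v; rewrite mulr_ge0.
  split; first by rewrite fineM// esum_fin_num.
  by rewrite lte_mul_pinfty// esum_ge0// => v _; rewrite lee_fin.
have [cp cpoo] := Z p p0 poo; have [cn cnoo] := Z n n0 noo.
have -> : (fun v => c * x v) = (fun v => c * p v - c * n v).
  by apply/funext => v; rewrite xE mulrBr.
rewrite rsumB//; [|by move=> v; rewrite mulr_ge0..].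
by rewrite (funext xE) rsumB// cp cn mulrBr.
Qed.

End RealSum.

(** * The inner product of l^2(V) *)

Section ComplexNorm.
Context {R : realType}.
Implicit Types z w : R[i].

Lemma normc2E z : nrm z ^+ 2 = complex.Re z ^+ 2 + complex.Im z ^+ 2.
Proof. by case: z => a b /=; rewrite sqr_sqrtr// addr_ge0// sqr_ge0. Qed.

Lemma normc2_ge0 z : 0 <= nrm z ^+ 2. Proof. exact: sqr_ge0. Qed.

Lemma normc_ge0 z : 0 <= nrm z. Proof. by case: z => a b /=; exact: sqrtr_ge0. Qed.

Lemma normc2M z w : nrm (z * w) ^+ 2 = nrm z ^+ 2 * nrm w ^+ 2.
Proof. by rewrite Normc.normcM exprMn. Qed.

Lemma normc2N z : nrm (- z) ^+ 2 = nrm z ^+ 2.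
Proof. by rewrite !normc2E; case: z => a b /=; rewrite !sqrrN. Qed.

Lemma normc2D z w : nrm (z + w) ^+ 2 <= 2 * (nrm z ^+ 2 + nrm w ^+ 2).
Proof.
rewrite !normc2E; case: z w => a b [c d] /=.
have := sqr_ge0 (a - c); have := sqr_ge0 (b - d); nra.
Qed.

Lemma normc2_eq0 z : nrm z ^+ 2 = 0 -> z = 0.
Proof.
by move/eqP; rewrite sqrf_eq0 => /eqP; exact: Normc.eq0_normc.
Qed.

Lemma normc2_real (c : R) : nrm (c%:C) ^+ 2 = c ^+ 2.
Proof. by rewrite normc2E /= expr0n addr0. Qed.

Lemma mul_conjc_self z : z * cj z = (nrm z ^+ 2)%:C.
Proof. by rewrite normc2E; case: z => a b; simpc; congr (_ +i* _); ring. Qed.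

Lemma conjcE (a b : R) : cj (a +i* b) = a +i* (- b). Proof. by []. Qed.

Lemma conjc_mul z w : cj (z * w) = cj z * cj w.
Proof. by case: z w => a b [c d]; simpc; congr (_ +i* _); ring. Qed.

Lemma conjc_add z w : cj (z + w) = cj z + cj w.
Proof. by case: z w => a b [c d]; simpc; congr (_ +i* _); ring. Qed.

Lemma normc2_conj z : nrm (cj z) ^+ 2 = nrm z ^+ 2.
Proof. by rewrite !normc2E; case: z => a b /=; rewrite sqrrN. Qed.

Lemma normr_Re_le z w : `|complex.Re (z * w)| <= nrm z ^+ 2 + nrm w ^+ 2.
Proof.
rewrite !normc2E; case: z w => a b [c d]; rewrite /= ler_norml.
have := sqr_ge0 (a - c); have := sqr_ge0 (b - d).
have := sqr_ge0 (a + c); have := sqr_ge0 (b + d).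
by move=> *; apply/andP; split; nra.
Qed.

Lemma normr_Im_le z w : `|complex.Im (z * w)| <= nrm z ^+ 2 + nrm w ^+ 2.
Proof.
rewrite !normc2E; case: z w => a b [c d]; rewrite /= ler_norml.
have := sqr_ge0 (a - d); have := sqr_ge0 (b - c).
have := sqr_ge0 (a + d); have := sqr_ge0 (b + c).
by move=> *; apply/andP; split; nra.
Qed.

End ComplexNorm.

Section ComplexSum.
Context {R : realType} {V : choiceType}.
Implicit Types z w : V -> R[i].

Definition csummable z :=
  rsummable (fun v => complex.Re (z v)) /\ rsummable (fun v => complex.Im (z v)).

Lemma rsummableZ (c : R) (x : V -> R) : rsummable x -> rsummable (fun v => c * x v).
Proof.
move=> xoo; apply: (@rsummable_le _ _ _ (fun v => `|c| * `|x v|)).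
  by move=> v; rewrite normrM.
under eq_esum do rewrite EFinM.
by rewrite esumZl// ?lte_mul_pinfty// esum_ge0// => v _; rewrite lee_fin.
Qed.

Lemma csumD z w : csummable z -> csummable w ->
  csum (fun v => z v + w v) = csum z + csum w.
Proof.
move=> [zr zi] [wr wi]; rewrite /csum; simpc.
rewrite -rsumD// -rsumD//.
by congr (_ +i* _); congr rsum; apply/funext => v; case: (z v) (w v) => ? ? [].
Qed.

Lemma csumZ a z : csummable z -> csum (fun v => a * z v) = a * csum z.
Proof.
move=> [zr zi]; rewrite /csum.
have lin (c d : R) : rsum (fun v => c * complex.Re (z v) + d * complex.Im (z v)) =
    c * rsum (fun v => complex.Re (z v)) + d * rsum (fun v => complex.Im (z v)).
  by rewrite (rsumD (rsummableZ c zr) (rsummableZ d zi)) (rsumZ c zr) (rsumZ d zi).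
case: a => a b.
have -> : (fun v => complex.Re ((a +i* b) * z v)) =
    (fun v => a * complex.Re (z v) + (- b) * complex.Im (z v)).
  by apply/funext => v; case: (z v) => c d /=; rewrite mulNr.
have -> : (fun v => complex.Im ((a +i* b) * z v)) =
    (fun v => b * complex.Re (z v) + a * complex.Im (z v)).
  by apply/funext => v; case: (z v) => c d /=; rewrite addrC.
by rewrite !lin; simpc; congr (_ +i* _); ring.
Qed.

Lemma csum_conj z : csummable z -> csum (fun v => cj (z v)) = cj (csum z).
Proof.
move=> [zr zi]; rewrite /csum conjcE -rsumN//.
by congr (_ +i* _); congr rsum; apply/funext => v; case: (z v).
Qed.

Lemma csum_real (x : V -> R) : (forall v, 0 <= x v) ->
  csum (fun v => (x v)%:C) = (fine (\esum_(v in setT) (x v)%:E))%:C.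
Proof.
move=> x0; rewrite /csum /= rsum_ge0E//; congr (_ +i* _).
by rewrite rsum_ge0E// esum1.
Qed.

End ComplexSum.

Section Ell2.
Context {R : realType} {V : choiceType}.
Implicit Types f g h : V -> R[i].

Lemma sqsum_ge0 f : (0 <= sqsum f)%E.
Proof. by apply: esum_ge0 => v _; rewrite lee_fin normc2_ge0. Qed.

Lemma sqsum_fin_num f : ell2 f -> sqsum f \is a fin_num.
Proof. by move=> f2; rewrite ge0_fin_numE ?sqsum_ge0. Qed.

Lemma fine_sqsumK f : ell2 f -> (fine (sqsum f))%:E = sqsum f.
Proof. by move=> /sqsum_fin_num; exact: fineK. Qed.

Lemma sqsum_le (c : R) f g : 0 <= c ->
  (forall v, nrm (f v) ^+ 2 <= c * nrm (g v) ^+ 2) -> (sqsum f <= c%:E * sqsum g)%E.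
Proof.
move=> c0 fg; rewrite /sqsum -esumZl//; last by move=> v; rewrite lee_fin normc2_ge0.
by apply: le_esum => v _; rewrite -EFinM lee_fin.
Qed.

Lemma ell2_le (c : R) f g : 0 <= c ->
  (forall v, nrm (f v) ^+ 2 <= c * nrm (g v) ^+ 2) -> ell2 g -> ell2 f.
Proof.
move=> c0 fg g2; apply: (le_lt_trans (sqsum_le c0 fg)).
by rewrite lte_mul_pinfty// sqsum_ge0.
Qed.

Lemma ell2_add f g : ell2 f -> ell2 g -> ell2 (fun v => f v + g v).
Proof.
move=> f2 g2; rewrite /ell2 /=.
apply: (@le_esum_lty _ _ _ _
  (fun v => 2%:E * ((nrm (f v) ^+ 2)%:E + (nrm (g v) ^+ 2)%:E))%E).
  by move=> v _; rewrite -EFinD -EFinM lee_fin normc2D.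
rewrite esumZl//; last by move=> v; rewrite -EFinD lee_fin addr_ge0 ?normc2_ge0.
rewrite esumD//; try by move=> v _; rewrite lee_fin normc2_ge0.
by rewrite lte_mul_pinfty ?adde_ge0 ?sqsum_ge0// lte_add_pinfty.
Qed.

Lemma ell2_scale a f : ell2 f -> ell2 (fun v => a * f v).
Proof.
by apply: (@ell2_le (nrm a ^+ 2)); rewrite ?normc2_ge0// => v; rewrite normc2M.
Qed.

Lemma ell2_lincomb a f g : ell2 f -> ell2 g -> ell2 (lincomb a f g).
Proof. by move=> f2 g2; apply: ell2_add => //; exact: ell2_scale. Qed.

Lemma ell2_vzero : ell2 (@vzero R V).
Proof. by rewrite /ell2/= /sqsum esum1 ?ltry// => v _; rewrite normc2_real expr0n. Qed.

Lemma sqsum_ebasis u : sqsum (@ebasis R V u) = 1%E.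
Proof.
rewrite /sqsum (esumID [set u])// ?setTI; last by move=> v _; rewrite lee_fin normc2_ge0.
rewrite esum_set1; last by rewrite lee_fin normc2_ge0.
rewrite esum1; first by rewrite /ebasis eqxx (normc2_real 1) expr1n adde0.
by move=> v /= /eqP /negbTE vu; rewrite /ebasis vu (normc2_real 0) expr0n.
Qed.

Lemma ell2_ebasis u : ell2 (@ebasis R V u).
Proof. by rewrite /ell2/= sqsum_ebasis ltry. Qed.

Lemma norm2_sqr f : norm2 f ^+ 2 = fine (sqsum f).
Proof. by rewrite /norm2 sqr_sqrtr// fine_ge0// sqsum_ge0. Qed.

Lemma norm2_ge0 f : 0 <= norm2 f. Proof. exact: sqrtr_ge0. Qed.

Lemma normc_le_norm2 f v : ell2 f -> nrm (f v) <= norm2 f.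
Proof.
move=> f2; rewrite -(@ler_pXn2r _ 2) ?nnegrE ?normc_ge0 ?norm2_ge0//.
rewrite norm2_sqr -lee_fin fine_sqsumK//.
apply: (@esum_ge_term _ _ _ (fun v => (nrm (f v) ^+ 2)%:E)) => // w.
by rewrite lee_fin normc2_ge0.
Qed.

Lemma norm2_lt f (e : R) : 0 < e -> (sqsum f < (e ^+ 2)%:E)%E -> norm2 f < e.
Proof.
move=> e0 fe; rewrite -(@ltr_pXn2r _ 2) ?nnegrE ?norm2_ge0 ?ltW//.
rewrite norm2_sqr -lte_fin fine_sqsumK//.
by apply: lt_trans fe _; rewrite ltry.
Qed.

Lemma sqsum_eq0 f : sqsum f = 0%E -> f = vzero.
Proof.
move=> f0; apply/funext => v; apply: normc2_eq0.
apply/eqP; rewrite -eqe; apply/eqP.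
apply: (@esum_eq0 _ _ [set: V] (fun v => (nrm (f v) ^+ 2)%:E) v) => // w.
by rewrite lee_fin normc2_ge0.
Qed.

Lemma csummable_inner f g : ell2 f -> ell2 g -> csummable (fun v => f v * cj (g v)).
Proof.
move=> f2 g2.
have fgoo : (\esum_(v in setT) (nrm (f v) ^+ 2 + nrm (g v) ^+ 2)%:E < +oo)%E.
  under eq_esum do rewrite EFinD.
  rewrite esumD//; try by move=> v _; rewrite lee_fin normc2_ge0.
  by rewrite lte_add_pinfty.
split; apply: rsummable_le fgoo => v; rewrite -(normc2_conj (g v)).
  exact: normr_Re_le.
exact: normr_Im_le.
Qed.

Lemma innerDl a f g h : ell2 f -> ell2 g -> ell2 h ->
  inner (lincomb a f g) h = a * inner f h + inner g h.
Proof.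
move=> f2 g2 h2; have fh := csummable_inner f2 h2; have gh := csummable_inner g2 h2.
have afh : csummable (fun v => a * (f v * cj (h v))).
  have := csummable_inner (ell2_scale a f2) h2.
  by under eq_fun do rewrite -mulrA.
rewrite /inner -(csumZ a fh) -(csumD afh gh).
by congr csum; apply/funext => v; rewrite /lincomb mulrDl mulrA.
Qed.

Lemma innerC f g : ell2 f -> ell2 g -> inner g f = cj (inner f g).
Proof.
move=> f2 g2; rewrite /inner -csum_conj; last exact: csummable_inner.
by congr csum; apply/funext => v; rewrite conjc_mul conjCK mulrC.
Qed.

Lemma innerDr a f g h : ell2 f -> ell2 g -> ell2 h ->
  inner h (lincomb a f g) = cj a * inner h f + inner h g.
Proof.
move=> f2 g2 h2; rewrite (innerC (ell2_lincomb a f2 g2) h2) innerDl//.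
by rewrite conjc_add conjc_mul (innerC f2 h2) (innerC g2 h2).
Qed.

Lemma inner_self f : inner f f = (fine (sqsum f))%:C.
Proof.
rewrite /inner; under eq_fun do rewrite mul_conjc_self.
by rewrite csum_real// => v; rewrite normc2_ge0.
Qed.

Lemma inner_ebasis f u : inner f (ebasis u) = f u.
Proof.
have E : (fun v => f v * cj (@ebasis R V u v)) =
    (fun v => f u * (ebasis u v * cj (ebasis u v))).
  apply/funext => v; rewrite /ebasis; case: eqP => [->|_].
    by rewrite conjC_nat !mulr1.
  by rewrite conjC_nat !mulr0.
rewrite /inner E csumZ; last by apply: csummable_inner; exact: ell2_ebasis.
by rewrite -/(inner _ _) inner_self sqsum_ebasis /= mulr1.
Qed.

(** Expanding the squared norms, the sum over the fourth roots of unity cancels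
every term but <f, h>. *)
Lemma polarization f h : ell2 f -> ell2 h ->
  inner f h = 4^-1 * \sum_(k < 4) 'i%C ^+ k *
    (fine (sqsum (lincomb ('i%C ^+ k) h f)))%:C.
Proof.
move=> f2 h2.
have E a : (fine (sqsum (lincomb a h f)))%:C =
    a * cj a * inner h h + a * inner h f + cj a * inner f h + inner f f.
  rewrite -inner_self innerDl ?innerDr//; last exact: ell2_lincomb.
  ring.
under eq_bigr do rewrite E.
rewrite !big_ord_recr big_ord0 /= add0r.
have i2 : 'i%C * 'i%C = -1 :> R[i] by simpc.
have ic : cj 'i%C = - 'i%C :> R[i] by rewrite conjcE; simpc.
have -> : 'i%C ^+ 3 = - 'i%C :> R[i] by rewrite exprS expr2 i2 mulrN1.
have -> : 'i%C ^+ 2 = -1 :> R[i] by rewrite expr2 i2.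
rewrite expr0 expr1 conjC1.
have -> : cj (- 'i%C) = 'i%C :> R[i] by simpc; rewrite conjcE opprK.
have -> : cj (-1) = -1 :> R[i] by rewrite rmorphN rmorph1.
rewrite ic.
have n4 : (4 : R[i]) != 0 by rewrite pnatr_eq0.
apply: (mulfI n4); rewrite mulrA divff// mul1r.
have i2' : ('i%C : R[i]) ^+ 2 = -1 by rewrite expr2.
by rewrite -[inner f h]mul1r; ring: i2'.
Qed.

End Ell2.

(** * Weighted shifts on a directed tree *)

Section Shift.
Context {R : realType} {V : choiceType}.
Variable E : rel V.
Hypothesis treeE : directed_tree E.
Implicit Types (lam f g : V -> R[i]).

Lemma par_eq u v : E u v -> par E v = u.
Proof.
move=> Euv; have := @xgetI _ v [set u | E u v] u Euv.
by move=> Ep; apply: (tree_parent treeE Ep Euv).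
Qed.

(** Every nonroot vertex has a single parent, so the sum over vertices may be
grouped by parents. *)
Lemma sqsum_wshift lam f : sqsum (wshift_fun E lam f) =
  (\esum_(u in setT) ((\esum_(v in chi E u) (nrm (lam v) ^+ 2)%:E)
                      * (nrm (f u) ^+ 2)%:E))%E.
Proof.
pose a v := (nrm (lam v * f (par E v)) ^+ 2)%:E.
have -> : sqsum (wshift_fun E lam f) = (\esum_(v in nonroot E) a v)%E.
  rewrite /sqsum [RHS]esum_mkcond; apply: eq_esum => v _.
  by rewrite /wshift_fun; case: ifP => // _; rewrite (normc2_real 0) expr0n.
have -> : (\esum_(u in setT) ((\esum_(v in chi E u) (nrm (lam v) ^+ 2)%:E)
      * (nrm (f u) ^+ 2)%:E) = \esum_(u in setT) \esum_(v in chi E u) a v)%E.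
  apply: eq_esum => u _; rewrite muleC -esumZl ?normc2_ge0//; last first.
    by move=> v; rewrite lee_fin normc2_ge0.
  by apply: eq_esum => v Euv; rewrite /a (par_eq Euv) -EFinM normc2M mulrC.
rewrite esum_esum; last by move=> u v _ _; rewrite lee_fin normc2_ge0.
apply: reindex_esum; split.
- by move=> [u v] [_ /= Euv]; exists u.
- move=> [u v] [u' v'] /set_mem [_ /= Euv] /set_mem [_ /= Eu'v'] /= vv'.
  by move: Euv; rewrite vv' => Euv'; rewrite (tree_parent treeE Euv' Eu'v').
- by move=> v [u Euv]; exists (u, v).
Qed.

(** By [sqsum_wshift] the condition defining the domain is that the image be
square-summable. *)
Lemma wshiftP lam f g : wshift E lam (f, g) <->
  [/\ ell2 f, ell2 g & g = wshift_fun E lam f].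
Proof.
rewrite /wshift /wshift_dom /= -sqsum_wshift; split; first by move=> [[f2 g2] ->].
by move=> [f2 g2 gE]; rewrite gE in g2 *.
Qed.

Lemma wshift_fun_lincomb lam a f g : wshift_fun E lam (lincomb a f g) =
  lincomb a (wshift_fun E lam f) (wshift_fun E lam g).
Proof.
apply/funext => v; rewrite /wshift_fun /lincomb; case: ifP => _; last by rewrite mulr0 addr0.
by rewrite mulrDr mulrCA.
Qed.

Lemma wshift_fun0 lam : wshift_fun E lam vzero = vzero.
Proof. by apply/funext => v; rewrite /wshift_fun /vzero mulr0 if_same. Qed.

Lemma wshift_linear lam : linear_operator (wshift E lam).
Proof.
split.
- by move=> f g /wshiftP[].
- by apply/wshiftP; split; rewrite ?wshift_fun0//; exact: ell2_vzero.
- move=> a f g f' g' /wshiftP[f2 g2 gE] /wshiftP[f2' g2' gE'].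
  by apply/wshiftP; rewrite wshift_fun_lincomb -gE -gE'; split=> //; exact: ell2_lincomb.
- by move=> f g g' /wshiftP[_ _ ->] /wshiftP[_ _ ->].
Qed.

Lemma sqsum_wshift_ebasis lam u : sqsum (wshift_fun E lam (ebasis u)) =
  (\esum_(v in chi E u) (nrm (lam v) ^+ 2)%:E)%E.
Proof.
have w0 v : (0 <= \esum_(v in chi E v) (nrm (lam v) ^+ 2)%:E)%E.
  by apply: esum_ge0 => w _; rewrite lee_fin normc2_ge0.
rewrite sqsum_wshift (esumID [set u])// ?setTI; last first.
  by move=> v _; rewrite mule_ge0// lee_fin normc2_ge0.
rewrite esum_set1; last by rewrite mule_ge0// lee_fin normc2_ge0.
rewrite [X in (_ + X)%E]esum1.
  by rewrite /ebasis eqxx (normc2_real 1) expr1n adde0 mule1.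
by move=> v /= /eqP /negbTE vu; rewrite /ebasis vu (normc2_real 0) expr0n mule0.
Qed.

(** A vertex with divergent weights would force every vector of the domain to
vanish there, so e_u would be at distance at least one from the domain. *)
Lemma ell2_wshift_ebasis lam u : densely_defined (wshift E lam) ->
  ell2 (wshift_fun E lam (ebasis u)).
Proof.
move=> dense; apply: contrapT => /negP; rewrite -leNgt leye_eq => /eqP woo.
have [f [g /wshiftP[f2 + gE]]] := dense _ (ell2_ebasis u) 1 ltr01.
rewrite {}gE => Sf2; apply/negP; rewrite -leNgt.
have fu0 : f u = 0.
  apply: contrapT => fu0; move: Sf2; apply/negP; rewrite -leNgt sqsum_wshift.
  rewrite sqsum_wshift_ebasis in woo.
  pose a v := ((\esum_(w in chi E v) (nrm (lam w) ^+ 2)%:E) * (nrm (f v) ^+ 2)%:E)%E.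
  have <- : a u = +oo%E.
    rewrite /a woo gt0_mulye// lte_fin lt_def normc2_ge0 andbT.
    by apply/eqP => /normc2_eq0.
  apply: esum_ge_term => // v; rewrite mule_ge0 ?lee_fin ?normc2_ge0//.
  by apply: esum_ge0 => w _; rewrite lee_fin normc2_ge0.
have := normc_le_norm2 u (ell2_lincomb (-1) f2 (ell2_ebasis u)).
by rewrite {1}/lincomb fu0 mulr0 add0r /ebasis eqxx Normc.normc1.
Qed.

(** The norm identity that identifies the modulus of S. *)
Lemma wshift_norm lam f : (forall u, ell2 (wshift_fun E lam (ebasis u))) ->
  sqsum (wshift_fun E lam f) =
  sqsum (fun u => (norm2 (wshift_fun E lam (ebasis u)))%:C * f u).
Proof.
move=> lam2; rewrite sqsum_wshift; apply: eq_esum => u _.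
by rewrite -sqsum_wshift_ebasis normc2M normc2_real norm2_sqr [RHS]EFinM fine_sqsumK.
Qed.

Lemma wshift_weight_eq0 lam u v : norm2 (wshift_fun E lam (ebasis u)) = 0 ->
  ell2 (wshift_fun E lam (ebasis u)) -> E u v -> lam v = 0.
Proof.
move=> n0 l2 Euv; have s0 : sqsum (wshift_fun E lam (ebasis u)) = 0%E.
  by rewrite -fine_sqsumK// -norm2_sqr n0 expr0n.
have := congr1 (@^~ v) (sqsum_eq0 s0).
rewrite /wshift_fun /vzero ifT; last by apply/mem_set; exists u.
by rewrite (par_eq Euv) /ebasis eqxx mulr1.
Qed.

End Shift.

(** * Integration against weighted counting measures *)

Section WeightedCounting.
Context {R : realType} {V : choiceType}.
Implicit Types (f : V -> R[i]) (b : V -> R).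

(** A vertex outside countably many finite sets, the n-th of which leaves out
less than 1/n of the sum, carries no mass. *)
Lemma countable_support f : ell2 f -> countable [set v | f v != 0].
Proof.
move=> f2.
have tail n : exists F : set V, finite_set F /\
    (\esum_(v in ~` F) (nrm (f v) ^+ 2)%:E < (n.+1%:R^-1)%:E)%E.
  have x0 v : (0 <= (nrm (f v) ^+ 2)%:E)%E by rewrite lee_fin normc2_ge0.
  have e0 : 0 < n.+1%:R^-1 :> R by rewrite invr_gt0.
  have [F finF tF] := esum_tail x0 f2 e0.
  by exists F.
have /choice[F HF] := tail.
apply: (@sub_countable _ _ _ (\bigcup_n F n)); last first.
  by apply: bigcup_countable => // n _; apply: finite_set_countable; exact: (HF n).1.
apply: subset_card_le => v /= fv0; apply: contrapT => nFv.
have f0 : 0 < nrm (f v) ^+ 2.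
  by rewrite lt_def normc2_ge0 andbT; apply: contra fv0 => /eqP /normc2_eq0 ->.
have [n] := ltr_add_invr f0; rewrite add0r => nf.
have := (HF n).2; apply/negP; rewrite -leNgt.
apply: (@le_trans _ _ (nrm (f v) ^+ 2)%:E); first by rewrite lee_fin ltW.
apply: (@esum_ge_term _ _ (~` F n) (fun v => (nrm (f v) ^+ 2)%:E)).
  by move=> w; rewrite lee_fin normc2_ge0.
by move=> Fv; apply: nFv; exists n.
Qed.

(** The weight |f|^2 is carried by countably many vertices, so that sums
against it become series, to which countable additivity applies. *)
Lemma ell2_series (v0 : V) f : ell2 f ->
  exists e : nat -> V, exists w : nat -> {nonneg R},
  forall G : V -> \bar R, (forall v, (0 <= G v)%E) ->
  (\esum_(v in setT) (G v * (nrm (f v) ^+ 2)%:E) =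
   \sum_(0 <= n <oo) ((w n)%:num%:E * G (e n)))%E.
Proof.
move=> f2; have /countable_injP[i iinj] := countable_support f2.
pose D := [set v | f v != 0].
(* Off the image of i the vertex e n is the dummy v0, and w n below is 0. *)
pose e n := xget v0 [set v | D v /\ i v = n].
have eK v : D v -> e (i v) = v.
  move=> Dv; have := @xgetI _ v0 [set v' | D v' /\ i v' = i v] v (conj Dv erefl).
  by case=> De ie; apply: iinj; rewrite ?inE.
pose w n := if n \in i @` D then NngNum (normc2_ge0 (f (e n)))
  else NngNum (lexx (0 : R)).
exists e, w => G G0.
rewrite nneseries_esumT; last by move=> n; rewrite mule_ge0.
transitivity (\esum_(v in D) (G v * (nrm (f v) ^+ 2)%:E))%E.
  rewrite [RHS]esum_mkcond; apply: eq_esum => v _; case: ifPn => //.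
  move=> /negP vD; have -> : f v = 0.
    by apply: contrapT => /eqP fv; apply: vD; rewrite inE.
  by rewrite (normc2_real 0) expr0n mule0.
transitivity (\esum_(n in i @` D) (G (e n) * (nrm (f (e n)) ^+ 2)%:E))%E.
  by rewrite esum_image//; apply: eq_esum => v Dv; rewrite eK.
rewrite esum_mkcond; apply: eq_esum => n _; rewrite /w; case: ifP => _ /=.
  by rewrite muleC.
by rewrite mul0e.
Qed.

(** The measure is a series of point masses, so integration is termwise. *)
Lemma integral_weighted (v0 : V) f b
    (nu : {measure set (measurableTypeR R) -> \bar R}) (g : measurableTypeR R -> \bar R) :
  ell2 f ->
  (forall C : set (measurableTypeR R), measurable C ->
     nu C = \esum_(v in setT) ((\1_C (b v))%:E * (nrm (f v) ^+ 2)%:E))%E ->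
  measurable_fun [set: measurableTypeR R] g -> (forall x, (0 <= g x)%E) ->
  (\int[nu]_(x in [set: measurableTypeR R]) g x =
   \esum_(v in setT) (g (b v) * (nrm (f v) ^+ 2)%:E))%E.
Proof.
move=> f2 nuE mg g0; have [e [w ewE]] := ell2_series v0 f2.
pose m n : {measure set (measurableTypeR R) -> \bar R} :=
  mscale (w n) (dirac (b (e n) : measurableTypeR R)).
rewrite (@eq_measure_integral _ _ _ _ (mseries m 0)); last first.
  move=> C mC _; rewrite nuE// (ewE (fun v => (\1_C (b v))%:E)); last first.
    by move=> v; rewrite lee_fin.
  by apply: eq_eseriesr => n _.
rewrite ge0_integral_measure_series// (ewE (g \o b)); last by move=> v; exact: g0.
apply: eq_eseriesr => n _.
rewrite ge0_integral_mscale// integral_dirac//.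
by rewrite diracT mul1e.
Qed.

End WeightedCounting.

(** * Multiplication operators and their spectral measures *)

Definition mul_fun {R : realType} {V : choiceType} (c : V -> R) (f : V -> R[i]) :
  V -> R[i] := fun v => (c v)%:C * f v.

Definition diag {R : realType} {V : choiceType} (c : V -> R) : op R V :=
  [set fg | [/\ ell2 fg.1, ell2 fg.2 & fg.2 = mul_fun c fg.1]].

Section Multiplication.
Context {R : realType} {V : choiceType}.
Implicit Types (f g h : V -> R[i]) (b c s : V -> R).

Lemma normc2_mul_fun c f v : nrm (mul_fun c f v) ^+ 2 = c v ^+ 2 * nrm (f v) ^+ 2.
Proof. by rewrite normc2M normc2_real. Qed.

Lemma mul_fun_lincomb c a f g :
  mul_fun c (lincomb a f g) = lincomb a (mul_fun c f) (mul_fun c g).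
Proof. by apply/funext => v; rewrite /mul_fun /lincomb mulrDr mulrCA. Qed.

Lemma mul_fun_ebasis c u : mul_fun c (ebasis u) = (fun v => (c u)%:C * @ebasis R V u v).
Proof.
by apply/funext => v; rewrite /mul_fun /ebasis; case: eqP => [->//|_]; rewrite !mulr0.
Qed.

Lemma ell2_mul_ebasis c u : ell2 (mul_fun c (ebasis u)).
Proof. by rewrite mul_fun_ebasis; apply: ell2_scale; exact: ell2_ebasis. Qed.

Lemma mul_fun_mul b c f : mul_fun b (mul_fun c f) = mul_fun (fun v => b v * c v) f.
Proof. by apply/funext => v; rewrite /mul_fun mulrA rmorphM. Qed.

Lemma ell2_mul_le c f : (forall v, `|c v| <= 1) -> ell2 f -> ell2 (mul_fun c f).
Proof.
move=> c1; apply: (@ell2_le _ _ 1) => // v; rewrite normc2_mul_fun.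
by rewrite ler_wpM2r ?normc2_ge0// -real_normK ?num_real// expr_le1.
Qed.

(** Because s^2 <= 1 + s^4. *)
Lemma ell2_mul_sqr s f : ell2 f -> ell2 (mul_fun (fun v => s v ^+ 2) f) ->
  ell2 (mul_fun s f).
Proof.
move=> f2 sf2; rewrite /ell2 /=.
apply: (@le_esum_lty _ _ _ _ (fun v => (nrm (f v) ^+ 2)%:E +
    (nrm (mul_fun (fun v => s v ^+ 2) f v) ^+ 2)%:E)%E).
  move=> v _; rewrite -EFinD lee_fin !normc2_mul_fun -[X in X + _]mul1r -mulrDl.
  rewrite ler_wpM2r ?normc2_ge0//.
  by have := sqr_ge0 (s v ^+ 2 - 1); have := sqr_ge0 (s v); nra.
rewrite esumD//; try by move=> v _; rewrite lee_fin normc2_ge0.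
by rewrite lte_add_pinfty.
Qed.

Lemma conj_real (x : R) : cj (x%:C) = x%:C.
Proof. by rewrite conjcE oppr0. Qed.

Lemma inner_mul_fun c f g : inner (mul_fun c f) g = inner f (mul_fun c g).
Proof.
congr csum; apply/funext => v.
by rewrite /mul_fun conjc_mul conj_real mulrA (mulrC (c v)%:C).
Qed.

Lemma inner_mul_self s f :
  inner (mul_fun (fun v => s v ^+ 2) f) f = (fine (sqsum (mul_fun s f)))%:C.
Proof. by rewrite -inner_self !inner_mul_fun mul_fun_mul. Qed.

End Multiplication.

Section DiagonalSpectralMeasure.
Context {R : realType} {V : choiceType}.
Implicit Types (f g h : V -> R[i]) (b : V -> R) (P : @spectral_measure R V).

Definition multiplication_measure P b := forall (B : set (measurableTypeR R)) f,
  measurable B -> ell2 f -> sproj P B f = mul_fun (fun v => \1_B (b v)) f.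

Lemma inner_indic (B : set R) b f : ell2 f ->
  (complex.Re (inner (mul_fun (fun v => \1_B (b v)) f) f))%:E =
  (\esum_(v in setT) ((\1_B (b v))%:E * (nrm (f v) ^+ 2)%:E))%E.
Proof.
move=> f2; have sE : (fun v => \1_B (b v)) = (fun v => (\1_B (b v) : R) ^+ 2).
  by apply/funext => v; rewrite indicE; case: (_ \in _); rewrite ?expr1n ?expr0n.
rewrite sE inner_mul_self /= fine_sqsumK.
  apply: eq_esum => v _; rewrite normc2_mul_fun EFinM.
  by rewrite -[X in X%:E]/((fun v => (\1_B (b v) : R) ^+ 2) v) -sE.
apply: ell2_mul_le => // v.
by rewrite indicE; case: (_ \in _); rewrite ?normr1 ?normr0.
Qed.

Lemma ell2_indic (B : set R) b f : ell2 f -> ell2 (mul_fun (fun v => \1_B (b v)) f).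
Proof.
by apply: ell2_mul_le => v; rewrite indicE; case: (_ \in _); rewrite ?normr1 ?normr0.
Qed.

Lemma weighted_measure_exists (v0 : V) b f :
  exists nu : {measure set (measurableTypeR R) -> \bar R}, ell2 f ->
  forall C : set (measurableTypeR R), measurable C ->
     nu C = (\esum_(v in setT) ((\1_C (b v))%:E * (nrm (f v) ^+ 2)%:E))%E.
Proof.
have [f2|nf2] := pselect (ell2 f); last by exists mzero.
have [e [w ewE]] := ell2_series v0 f2.
pose m n : {measure set (measurableTypeR R) -> \bar R} :=
  mscale (w n) (dirac (b (e n) : measurableTypeR R)).
exists (mseries m 0) => _ C mC.
rewrite (ewE (fun v => (\1_C (b v))%:E)); last by move=> v; rewrite lee_fin.
by apply: eq_eseriesr => n _.
Qed.

Lemma indic_projection b (B : set R) :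
  orthogonal_projection (fun f => mul_fun (fun v => \1_B (b v)) f).
Proof.
split=> [f|a f g _ _|f _|f g _ _].
- exact: ell2_indic.
- exact: mul_fun_lincomb.
- rewrite mul_fun_mul; congr mul_fun; apply/funext => v.
  by rewrite indicE; case: (_ \in _); rewrite ?mulr1 ?mulr0.
- exact: inner_mul_fun.
Qed.

Lemma multiplication_measure_exists (v0 : V) b :
  exists P, multiplication_measure P b.
Proof.
have [nu nuE] := choice (weighted_measure_exists v0 b).
have smeasP f (B : set (measurableTypeR R)) : ell2 f -> measurable B ->
    nu f B = (complex.Re (inner (mul_fun (fun v => \1_B (b v)) f) f))%:E.
  by move=> f2 mB; rewrite nuE// inner_indic.
have projT f : ell2 f -> mul_fun (fun v => \1_[set: R] (b v)) f = f.
  by move=> _; apply/funext => v; rewrite /mul_fun indicT mul1r.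
by exists (SpectralMeasure (fun B _ => indic_projection b B) projT smeasP).
Qed.

Section Integral.
Variables (v0 : V) (P : @spectral_measure R V) (b : V -> R) (phi : R -> R).
Hypotheses (Pb : multiplication_measure P b) (phi_ge0 : forall v, 0 <= phi (b v))
  (mphi : measurable_fun [set: R] phi).

Let smeasPE f : ell2 f -> forall C : set (measurableTypeR R), measurable C ->
  smeas P f C = (\esum_(v in setT) ((\1_C (b v))%:E * (nrm (f v) ^+ 2)%:E))%E.
Proof. by move=> f2 C mC; rewrite smeasE// Pb// inner_indic. Qed.

Lemma spectral_domE f : spectral_dom P phi f <-> ell2 f /\ ell2 (mul_fun (phi \o b) f).
Proof.
suff intE : ell2 f ->
    (\int[smeas P f]_(x in [set: measurableTypeR R]) ((phi x) ^+ 2)%:E)%E =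
    sqsum (mul_fun (phi \o b) f).
  by rewrite /spectral_dom /=; split=> -[f2]; rewrite intE.
move=> f2; rewrite (integral_weighted v0 f2 (smeasPE f2)).
- by apply: eq_esum => v _; rewrite normc2_mul_fun EFinM.
- by apply/measurable_EFinP; apply: measurable_funX.
- by move=> x; rewrite lee_fin sqr_ge0.
Qed.

Let s := fun v => Num.sqrt (phi (b v)).

Let sE : (fun v => s v ^+ 2) = phi \o b.
Proof. by apply/funext => v; rewrite /s sqr_sqrtr. Qed.

(** As phi o b is nonnegative the integral is a squared norm, which makes
[polarization] applicable to the polarized integral. *)
Lemma Rintegral_smeas f : ell2 f ->
  Rintegral (smeas P f) [set: measurableTypeR R] phi = fine (sqsum (mul_fun s f)).
Proof.
move=> f2; rewrite /Rintegral integralE.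
have mE : measurable_fun [set: measurableTypeR R] (EFin \o phi).
  exact/measurable_EFinP.
rewrite !(integral_weighted v0 f2 (smeasPE f2)) //; last 2 first.
- exact: measurable_funeneg.
- exact: measurable_funepos.
rewrite [X in (_ - X)%E]esum1 ?sube0; last first.
  by move=> v _; rewrite funenegE /= max_r ?mul0e// lee_fin oppr_le0.
congr fine; apply: eq_esum => v _.
by rewrite funeposE /= max_l ?lee_fin// normc2_mul_fun /s sqr_sqrtr.
Qed.

Lemma polarized_integralE f h : spectral_dom P phi f -> spectral_dom P phi h ->
  polarized_integral P phi f h = inner (mul_fun (phi \o b) f) h.
Proof.
move=> /spectral_domE[f2 +] /spectral_domE[h2 +]; rewrite -sE => phif phih.
rewrite /polarized_integral.
have E (k : 'I_4) : Rintegral (smeas P (lincomb ('i%C ^+ k) h f))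
      [set: measurableTypeR R] phi =
    fine (sqsum (lincomb ('i%C ^+ k) (mul_fun s h) (mul_fun s f))).
  by rewrite -mul_fun_lincomb Rintegral_smeas//; exact: ell2_lincomb.
under eq_bigr do rewrite E.
rewrite -(polarization (ell2_mul_sqr f2 phif) (ell2_mul_sqr h2 phih)).
by rewrite !inner_mul_fun mul_fun_mul.
Qed.

(** Testing the weak equation against the basis vectors recovers g pointwise. *)
Lemma spectral_integralE : spectral_integral P phi = diag (phi \o b).
Proof.
have dome u : spectral_dom P phi (ebasis u).
  by apply/spectral_domE; split; [exact: ell2_ebasis|exact: ell2_mul_ebasis].
apply/seteqP; split => -[f g] /=; rewrite /spectral_integral /diag /=.
- move=> [domf g2 gE]; have [f2 _] := (spectral_domE f).1 domf.
  split=> //; apply/funext => u.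
  by rewrite -inner_ebasis gE// polarized_integralE// inner_ebasis.
- move=> [f2 g2 gE]; have domf : spectral_dom P phi f.
    by apply/spectral_domE; split; rewrite // -gE.
  by split=> // h domh; rewrite polarized_integralE// gE.
Qed.

End Integral.
End DiagonalSpectralMeasure.

(** * Uniqueness of the spectral measure of a multiplication operator *)

Section SpectralProjections.
Context {R : realType} {V : choiceType}.
Variable P : @spectral_measure R V.
Implicit Types (f g h k : V -> R[i]) (A B C : set (measurableTypeR R)).

Lemma sproj_lincomb B a f g : measurable B -> ell2 f -> ell2 g ->
  sproj P B (lincomb a f g) = lincomb a (sproj P B f) (sproj P B g).
Proof. by move=> mB f2 g2; have [_ + _ _] := sproj_orth P mB; exact. Qed.

Lemma ell2_sproj B f : measurable B -> ell2 f -> ell2 (sproj P B f).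
Proof. by move=> mB; have [+ _ _ _] := sproj_orth P mB; exact. Qed.

Lemma sproj_idem B f : measurable B -> ell2 f -> sproj P B (sproj P B f) = sproj P B f.
Proof. by move=> mB; have [_ _ + _] := sproj_orth P mB; exact. Qed.

Lemma inner_sproj B f g : measurable B -> ell2 f -> ell2 g ->
  inner (sproj P B f) g = inner f (sproj P B g).
Proof. by move=> mB; have [_ _ _ +] := sproj_orth P mB; exact. Qed.

Lemma smeas_sqsum B f : measurable B -> ell2 f -> smeas P f B = sqsum (sproj P B f).
Proof.
move=> mB f2; have Pf2 := ell2_sproj mB f2.
by rewrite smeasE// -{1}(sproj_idem mB f2) inner_sproj// inner_self fine_sqsumK.
Qed.

Lemma smeas_fin_num B f : measurable B -> ell2 f -> smeas P f B \is a fin_num.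
Proof. by move=> mB f2; rewrite smeas_sqsum// sqsum_fin_num//; exact: ell2_sproj. Qed.

Lemma sqsum_vzero : sqsum (@vzero R V) = 0%E.
Proof. by apply: esum1 => v _; rewrite (normc2_real 0) expr0n. Qed.

Lemma lincomb_subvv f : lincomb (-1) f f = vzero.
Proof. by apply/funext => v; rewrite /lincomb mulN1r addNr. Qed.

Lemma lincomb_sub_eq0 f g : lincomb (-1) f g = vzero -> f = g.
Proof.
move=> fg; apply/funext => v; apply/esym/eqP; rewrite -subr_eq0; apply/eqP.
by rewrite addrC -mulN1r; exact: (congr1 (@^~ v) fg).
Qed.

Lemma sproj_eq0 B f : measurable B -> ell2 f -> smeas P f B = 0%E ->
  sproj P B f = vzero.
Proof. by move=> mB f2; rewrite smeas_sqsum//; exact: sqsum_eq0. Qed.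

(** Monotonicity of the measure <P(.)f, f>. *)
Lemma sproj_eq0_sub C B f : measurable C -> measurable B -> C `<=` B -> ell2 f ->
  sproj P B f = vzero -> sproj P C f = vzero.
Proof.
move=> mC mB CB f2 PB0; apply: sproj_eq0 => //; apply/eqP.
rewrite eq_le measure_ge0 andbT (@le_trans _ _ (smeas P f B))//.
  by apply: le_measure; rewrite ?inE.
by rewrite smeas_sqsum// PB0 sqsum_vzero.
Qed.

(** The vector f - P(B)f has no mass on B, hence none on C. *)
Lemma sproj_sub C B f : measurable C -> measurable B -> C `<=` B -> ell2 f ->
  sproj P C (sproj P B f) = sproj P C f.
Proof.
move=> mC mB CB f2; have PB2 := ell2_sproj mB f2; apply: lincomb_sub_eq0.
rewrite -sproj_lincomb//; apply: (sproj_eq0_sub mC mB CB).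
  exact: ell2_lincomb.
by rewrite sproj_lincomb// sproj_idem// lincomb_subvv.
Qed.

(** All the mass of P(B)f lies on B, which leaves none for C. *)
Lemma sproj_disj C B f : measurable C -> measurable B -> C `<=` ~` B -> ell2 f ->
  sproj P C (sproj P B f) = vzero.
Proof.
move=> mC mB CB f2; have PB2 := ell2_sproj mB f2.
have mCB := measurableC mB.
apply: (sproj_eq0_sub mC mCB CB PB2); apply: sproj_eq0 => //.
have BT : smeas P (sproj P B f) [set: measurableTypeR R] = smeas P (sproj P B f) B.
  by rewrite !smeas_sqsum// sproj_idem// sproj_setT.
have : smeas P (sproj P B f) [set: measurableTypeR R] =
    (smeas P (sproj P B f) B + smeas P (sproj P B f) (~` B))%E.
  by rewrite -(setUv B) measureU// setICr.
rewrite BT => e; have fB := smeas_fin_num mB PB2.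
by rewrite -[LHS](addeK _ fB) [X in (X - _)%E]addeC -e subee.
Qed.

(** The vector f - P(B)f has mass neither on B nor on its complement. *)
Lemma sproj_id B f : measurable B -> ell2 f -> sproj P (~` B) f = vzero ->
  sproj P B f = f.
Proof.
move=> mB f2 PC0; have PB2 := ell2_sproj mB f2; have mCB := measurableC mB.
apply: lincomb_sub_eq0; apply: sqsum_eq0.
have k2 := ell2_lincomb (-1) PB2 f2.
rewrite -[lincomb _ _ _](sproj_setT P k2) -smeas_sqsum//.
set k := lincomb _ _ _ in k2 *.
have -> : smeas P k [set: measurableTypeR R] = (smeas P k B + smeas P k (~` B))%E.
  by rewrite -(setUv B) measureU// setICr.
rewrite !smeas_sqsum// !sproj_lincomb//.
by rewrite sproj_idem// lincomb_subvv sproj_disj// PC0 lincomb_subvv sqsum_vzero adde0.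
Qed.

(** As P(A) sends z P(B)f + f to (1 + z) P(A)f when A lies in B and to P(A)f when
A misses B, the measure of this vector has density |1 + z|^2 on B and 1 off B
with respect to that of f. *)
Lemma smeas_perturb_sub z A B f : measurable A -> measurable B -> A `<=` B -> ell2 f ->
  smeas P (lincomb z (sproj P B f) f) A = ((nrm (1 + z) ^+ 2)%:E * smeas P f A)%E.
Proof.
move=> mA mB AB f2; have PB2 := ell2_sproj mB f2.
rewrite !smeas_sqsum//; last exact: ell2_lincomb.
rewrite sproj_lincomb// sproj_sub// /sqsum -esumZl ?normc2_ge0//; last first.
  by move=> v; rewrite lee_fin normc2_ge0.
apply: eq_esum => v _; rewrite /lincomb -EFinM -normc2M.
by rewrite mulrDl mul1r addrC.
Qed.

Lemma smeas_perturb_disj z A B f : measurable A -> measurable B -> A `<=` ~` B ->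
  ell2 f -> smeas P (lincomb z (sproj P B f) f) A = smeas P f A.
Proof.
move=> mA mB AB f2; have PB2 := ell2_sproj mB f2.
rewrite !smeas_sqsum//; last exact: ell2_lincomb.
rewrite sproj_lincomb// sproj_disj//; congr sqsum; apply/funext => v.
by rewrite /lincomb /vzero mulr0 add0r.
Qed.

Lemma ge0_integral_split (mu nu : {measure set (measurableTypeR R) -> \bar R})
    B (c d : {nonneg R}) (g : R -> \bar R) : measurable B ->
  (forall A, measurable A -> A `<=` B -> nu A = (c%:num%:E * mu A)%E) ->
  (forall A, measurable A -> A `<=` ~` B -> nu A = (d%:num%:E * mu A)%E) ->
  measurable_fun [set: R] g -> (forall x, (0 <= g x)%E) ->
  (\int[nu]_(x in [set: measurableTypeR R]) g x =
   c%:num%:E * \int[mu]_(x in B) g x + d%:num%:E * \int[mu]_(x in ~` B) g x)%E.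
Proof.
move=> mB cE dE mg g0; have mCB := measurableC mB.
have mgS (D : set (measurableTypeR R)) : measurable_fun D (g : measurableTypeR R -> \bar R).
  exact: measurable_funTS.
rewrite -(setUv B) ge0_integral_setU//; last by rewrite disj_set2E setICr.
rewrite (@eq_measure_integral _ _ _ B (mscale c mu))// ge0_integral_mscale//.
by rewrite (@eq_measure_integral _ _ _ (~` B) (mscale d mu))// ge0_integral_mscale.
Qed.

End SpectralProjections.

Section MeasureTools.
Context {R : realType}.
Variable mu : {measure set (measurableTypeR R) -> \bar R}.
Hypothesis mu_fin : (mu [set: measurableTypeR R] < +oo)%E.

Lemma measure_sub_fin (B : set (measurableTypeR R)) : measurable B ->
  mu B \is a fin_num.
Proof.
move=> mB; rewrite ge0_fin_numE//; apply: le_lt_trans mu_fin.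
by apply: le_measure; rewrite ?inE.
Qed.

(** Because |x| <= 1 + x^2 and the measure is finite. *)
Lemma integrable_id_sqr :
  (\int[mu]_(x in [set: measurableTypeR R]) ((x : R) ^+ 2)%:E < +oo)%E ->
  mu.-integrable [set: measurableTypeR R] (EFin \o (id : measurableTypeR R -> R)).
Proof.
move=> sqoo; have mid : measurable_fun [set: measurableTypeR R]
    (EFin \o (id : measurableTypeR R -> R)).
  by apply/measurable_EFinP; exact: measurable_id.
apply/integrableP; split => //.
apply: (@le_lt_trans _ _ (\int[mu]_(x in [set: measurableTypeR R])
    (1 + ((x : R) ^+ 2)%:E))%E).
  apply: ge0_le_integral => //.
  - by apply: measurableT_comp.
  - by apply/measurable_EFinP; apply: measurable_funD => //; exact: measurable_funX.
  move=> x _ /=; rewrite -EFinD lee_fin.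
  have := sqr_ge0 (`|x : R| - 1); have := normr_ge0 (x : R).
  by rewrite -[X in _ <= 1 + X]real_normK ?num_real//; nra.
rewrite ge0_integralD//; last 2 first.
- by move=> x _; rewrite lee_fin sqr_ge0.
- by apply/measurable_EFinP; exact: measurable_funX.
by rewrite lte_add_pinfty// integral_cst// mul1e.
Qed.

(** The sign of s tells on which side of a the set B lies: a positive function
with integral 0 over B forces B to be null. *)
Lemma measure0_of_mean (B : set (measurableTypeR R)) (a s : R) : measurable B ->
  mu.-integrable [set: measurableTypeR R] (EFin \o (id : measurableTypeR R -> R)) ->
  (\int[mu]_(x in B) (x : R)%:E = a%:E * mu B)%E ->
  (forall x, B x -> 0 < s * (x - a)) -> mu B = 0%E.
Proof.
move=> mB intid mean sB.
have intB : mu.-integrable B (EFin \o (id : measurableTypeR R -> R)).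
  by apply: integrableS intid.
have intc : mu.-integrable B (EFin \o (cst a : measurableTypeR R -> R)).
  apply/integrableP; split; first by apply/measurable_EFinP; exact: measurable_cst.
  rewrite [X in (X < _)%E](_ : _ = (`|a|%:E * mu B)%E); last first.
    exact: (integral_cst mu mB `|a|%:E).
  by rewrite -(fineK (measure_sub_fin mB)) -EFinM ltry.
have int0 : (\int[mu]_(x in B) ((x : R)%:E - a%:E) = 0)%E.
  rewrite (integralB_EFin mB intB intc) mean.
  rewrite [X in (_ - X)%E](_ : _ = (a%:E * mu B)%E); last first.
    exact: (integral_cst mu mB a%:E).
  by rewrite subee// fin_numM// measure_sub_fin.
pose g (x : measurableTypeR R) := ((s * (x - a))%:E)%E.
have mg : measurable_fun B g.
  apply/measurable_EFinP; apply: measurable_funM => //.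
  by apply: measurable_funB => //; exact: measurable_cst.
have : (\int[mu]_(x in B) `|g x| = 0)%E.
  transitivity (\int[mu]_(x in B) (s%:E * ((x : R)%:E - a%:E)))%E.
    apply: eq_integral => x /[!inE] Bx; rewrite /g -EFinB -EFinM gee0_abs//.
    by rewrite lee_fin ltW// sB.
  rewrite integralZl//; first by rewrite int0 mule0.
  exact: integrableB.
move=> /(ae_eq_integral_abs mu mB mg) [N [mN N0 subN]].
apply/eqP; rewrite eq_le measure_ge0 andbT -N0.
apply: le_measure; rewrite ?inE// => x Bx; apply: subN => /= /(_ Bx).
by rewrite /g => -[] /eqP; rewrite gt_eqF// sB.
Qed.

End MeasureTools.

(** The q cancel because the fourth roots of unity add up to 0, while the factors
|1 + i^k|^2 are 4, 2, 0, 2. *)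
Lemma polarize_perturb {R : realType} (p q : R) :
  4^-1 * \sum_(k < 4) 'i%C ^+ k * (nrm (1 + 'i%C ^+ k) ^+ 2 * p + q)%:C = p%:C.
Proof.
have E (a : R[i]) : (nrm (1 + a) ^+ 2 * p + q)%:C = (1 + a) * (1 + cj a) * p%:C + q%:C.
  have := mul_conjc_self (1 + a); rewrite conjc_add conjC1 => ->.
  by rewrite rmorphD rmorphM.
under eq_bigr do rewrite E.
rewrite !big_ord_recr big_ord0 [in LHS]/= add0r.
have i2 : ('i%C : R[i]) ^+ 2 = -1 by rewrite expr2; simpc.
have ic : cj 'i%C = - 'i%C :> R[i] by rewrite conjcE; simpc.
have -> : 'i%C ^+ 3 = - 'i%C :> R[i] by rewrite exprS i2 mulrN1.
have -> : cj (- 'i%C) = 'i%C :> R[i] by simpc; rewrite conjcE opprK.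
have n4 : (4 : R[i]) != 0 by rewrite pnatr_eq0.
rewrite i2 expr0 expr1 conjC1 ic.
have -> : cj (-1) = -1 :> R[i] by rewrite rmorphN rmorph1.
by apply: (mulfI n4); rewrite mulrA divff// mul1r; ring: i2.
Qed.

Section Uniqueness.
Context {R : realType} {V : choiceType}.
Variable P : @spectral_measure R V.
Implicit Types (f g h : V -> R[i]) (b : V -> R) (B : set (measurableTypeR R)).

Let mid : measurable_fun [set: R] (EFin \o (id : R -> R)).
Proof. by apply/measurable_EFinP; exact: measurable_id. Qed.

Lemma smeas_setT_fin f : ell2 f -> (smeas P f [set: measurableTypeR R] < +oo)%E.
Proof. by move=> f2; rewrite smeas_sqsum// sproj_setT. Qed.

Lemma spectral_dom_sproj B f : measurable B -> spectral_dom P id f ->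
  spectral_dom P id (sproj P B f).
Proof.
move=> mB [f2 sqf]; split; first exact: ell2_sproj.
have Pf2 := ell2_sproj P mB f2.
have c1 A : measurable A -> A `<=` B ->
    smeas P (sproj P B f) A = ((NngNum (@ler01 R))%:num%:E * smeas P f A)%E.
  by move=> mA AB; rewrite !smeas_sqsum// sproj_sub// mul1e.
have c0 A : measurable A -> A `<=` ~` B ->
    smeas P (sproj P B f) A = ((NngNum (lexx (0 : R)))%:num%:E * smeas P f A)%E.
  by move=> mA AB; rewrite smeas_sqsum// sproj_disj// sqsum_vzero mul0e.
have mX : measurable_fun [set: R] (fun x : R => (x ^+ 2)%:E).
  by apply/measurable_EFinP; exact: measurable_funX.
rewrite (ge0_integral_split mB c1 c0 mX); last by move=> x; rewrite lee_fin sqr_ge0.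
rewrite mul1e mul0e adde0; apply: le_lt_trans sqf.
by apply: ge0_subset_integral => // x _; rewrite lee_fin sqr_ge0.
Qed.

Lemma Rintegral_perturb z B f : measurable B -> spectral_dom P id f ->
  Rintegral (smeas P (lincomb z (sproj P B f) f)) [set: measurableTypeR R] id =
  nrm (1 + z) ^+ 2 * fine (\int[smeas P f]_(x in B) (x : R)%:E)%E +
  fine (\int[smeas P f]_(x in ~` B) (x : R)%:E)%E.
Proof.
move=> mB [f2 sqf]; have mCB := measurableC mB.
have int := integrable_id_sqr (smeas_setT_fin f2) sqf.
have intS (D : set (measurableTypeR R)) : measurable D ->
    (smeas P f).-integrable D (EFin \o (id : measurableTypeR R -> R)).
  by move=> mD; apply: integrableS int.
have onB A : measurable A -> A `<=` B ->
    smeas P (lincomb z (sproj P B f) f) A =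
    ((NngNum (normc2_ge0 (1 + z)))%:num%:E * smeas P f A)%E.
  by move=> mA AB; exact: smeas_perturb_sub.
have offB A : measurable A -> A `<=` ~` B ->
    smeas P (lincomb z (sproj P B f) f) A =
    ((NngNum (@ler01 R))%:num%:E * smeas P f A)%E.
  by move=> mA AB; rewrite smeas_perturb_disj// mul1e.
rewrite /Rintegral integralE.
rewrite (ge0_integral_split mB onB offB (measurable_funepos mid))//.
rewrite (ge0_integral_split mB onB offB (measurable_funeneg mid))//.
rewrite [in RHS]integralE [X in _ + fine X]integralE.
have pB := integrable_pos_fin_num mB (intS _ mB).
have nB := integrable_neg_fin_num mB (intS _ mB).
have pC := integrable_pos_fin_num mCB (intS _ mCB).
have nC := integrable_neg_fin_num mCB (intS _ mCB).
move: pB nB pC nC => /fineK <- /fineK <- /fineK <- /fineK <-.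
rewrite -!EFinM -!EFinD /=; ring.
Qed.

(** Polarization of the fact that <P(.)f, P(B)f> is the restriction of
<P(.)f, f> to B. *)
Lemma polarized_integral_sproj B f : measurable B -> spectral_dom P id f ->
  polarized_integral P id f (sproj P B f) =
  (fine (\int[smeas P f]_(x in B) (x : R)%:E)%E)%:C.
Proof.
move=> mB domf; rewrite /polarized_integral.
under eq_bigr do rewrite Rintegral_perturb//.
exact: polarize_perturb.
Qed.

Section DiagonalIntegral.
Variable b : V -> R.
Hypothesis Pb : spectral_integral P id = diag b.

Lemma spectral_integral_ebasis u :
  spectral_integral P id (ebasis u, mul_fun b (ebasis u)).
Proof. by rewrite Pb; split => //; [exact: ell2_ebasis|exact: ell2_mul_ebasis]. Qed.

(** This is A e_u = b(u) e_u tested against P(B)e_u. *)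
Lemma mean_smeas_ebasis u B : measurable B ->
  (\int[smeas P (ebasis u)]_(x in B) (x : R)%:E =
   (b u)%:E * smeas P (ebasis u) B)%E.
Proof.
move=> mB; have [dome _ /(_ (sproj P B (ebasis u)))] := spectral_integral_ebasis u.
have e2 := @ell2_ebasis R V u; have h2 := ell2_sproj P mB e2.
move=> /(_ (spectral_dom_sproj mB dome)); rewrite polarized_integral_sproj//=.
have hu : sproj P B (ebasis u) u = (fine (smeas P (ebasis u) B))%:C.
  rewrite -inner_ebasis -{1}(sproj_idem P mB e2) inner_sproj// inner_self.
  by rewrite smeas_sqsum.
have -> : mul_fun b (ebasis u) = mul_fun (fun=> b u) (ebasis u) by rewrite mul_fun_ebasis.
rewrite inner_mul_fun innerC//; last exact: ell2_scale.
rewrite inner_ebasis /mul_fun hu -rmorphM conj_real => /(congr1 (@complex.Re _)) /= intE.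
have int := integrable_id_sqr (smeas_setT_fin e2) dome.2.
rewrite -[RHS]fineK; last by rewrite fin_numM// smeas_fin_num.
rewrite fineM ?smeas_fin_num//= intE fineK//.
by apply: integrable_fin_num => //; apply: integrableS int.
Qed.

(** By [mean_smeas_ebasis] the half-lines on either side of b(u) are null. *)
Lemma smeas_ebasis_eq0 u B : measurable B -> ~ B (b u) -> smeas P (ebasis u) B = 0%E.
Proof.
move=> mB nBb; have e2 := @ell2_ebasis R V u.
have [dome _ _] := spectral_integral_ebasis u.
have int := integrable_id_sqr (smeas_setT_fin e2) dome.2.
have mlt : measurable ([set` `]-oo, b u[] : set (measurableTypeR R)).
  exact: measurable_itv.
have mgt : measurable ([set` `]b u, +oo[] : set (measurableTypeR R)).
  exact: measurable_itv.
have lt0 : smeas P (ebasis u) [set` `]-oo, b u[] = 0%E.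
  apply: (measure0_of_mean (smeas_setT_fin e2) (s := -1) mlt int (mean_smeas_ebasis u mlt)).
  by move=> x /=; rewrite in_itv /=; lra.
have gt0 : smeas P (ebasis u) [set` `]b u, +oo[] = 0%E.
  apply: (measure0_of_mean (smeas_setT_fin e2) (s := 1) mgt int (mean_smeas_ebasis u mgt)).
  by move=> x /=; rewrite in_itv /= andbT; lra.
have sub : B `<=` [set` `]-oo, b u[] `|` [set` `]b u, +oo[].
  move=> x Bx; have [xb|xb|xb] := ltgtP x (b u).
  - by left; rewrite /= in_itv.
  - by right; rewrite /= in_itv /= andbT.
  - by rewrite xb in Bx.
apply/eqP; rewrite eq_le measure_ge0 andbT.
apply: (@le_trans _ _ (smeas P (ebasis u) ([set` `]-oo, b u[] `|` [set` `]b u, +oo[]))).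
  by apply: le_measure; rewrite ?inE//; exact: measurableU.
apply: (@le_trans _ _ (smeas P (ebasis u) [set` `]-oo, b u[] +
    smeas P (ebasis u) [set` `]b u, +oo[])%E); first exact: measureU2.
by rewrite lt0 gt0 adde0.
Qed.

(** P(B)e_u is e_u or 0 according to whether b(u) lies in B; since P(B) is
selfadjoint, this determines its coordinates on every vector. *)
Lemma multiplication_measure_unique : multiplication_measure P b.
Proof.
move=> B f mB f2; apply/funext => u; have e2 := @ell2_ebasis R V u.
rewrite -[LHS]inner_ebasis inner_sproj// /mul_fun indicE.
have mCB := measurableC mB.
have [Bb|nBb] := pselect (B (b u)).
  rewrite mem_set// mul1r sproj_id ?inner_ebasis//.
  by apply: sproj_eq0 => //; apply: smeas_ebasis_eq0 => //; exact.
rewrite memNset// mul0r sproj_eq0//; last exact: smeas_ebasis_eq0.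
rewrite -[RHS]conjC0 innerC//; last exact: ell2_vzero.
congr (cj _); rewrite /inner /vzero.
by under eq_fun do rewrite mul0r; rewrite /csum rsum_ge0E// esum1.
Qed.

End DiagonalIntegral.
End Uniqueness.

(** Every spectral measure that represents multiplication by b is the canonical
one, so the choice made in the definition of the power is immaterial. *)
Lemma op_pow_diag {R : realType} {V : choiceType} (v0 : V) (b : V -> R) (s : R) :
  (forall v, 0 <= b v) -> op_pow (diag b) s = diag (fun v => b v `^ s).
Proof.
move=> b0; have powE P : multiplication_measure P b ->
    spectral_integral P (fun x => x `^ s) = diag (fun v => b v `^ s).
  move=> Pb; apply: (spectral_integralE v0 Pb); last exact: measurable_powR.
  by move=> v; exact: powR_ge0.
apply/seteqP; split => -[f g].
  by move=> [P /multiplication_measure_unique Pb]; rewrite powE.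
have [P Pb] := multiplication_measure_exists v0 b.
move=> fg; exists P; last by rewrite powE.
by apply: (spectral_integralE v0 Pb) => //; exact: measurable_id.
Qed.

(** * Truncation to finitely many vertices *)

Section FiniteSupport.
Context {R : realType} {V : choiceType}.
Implicit Types (f g : V -> R[i]) (s : seq V).

Definition truncation s f : V -> R[i] := mul_fun (fun v => (v \in s)%:R) f.

Definition rest s f : V -> R[i] := mul_fun (fun v => (v \notin s)%:R) f.

Lemma sub_truncation s f : lincomb (-1) (truncation s f) f = rest s f.
Proof.
apply/funext => v; rewrite /lincomb /truncation /rest /mul_fun.
by case: (v \in s) => /=; rewrite ?mul0r ?mul1r ?mulr0 ?add0r ?mulN1r ?addNr.
Qed.

Lemma truncation_ind (A : set (V -> R[i])) s f : A vzero ->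
  (forall u, A (ebasis u)) ->
  (forall a g h, A g -> A h -> A (lincomb a g h)) -> A (truncation s f).
Proof.
move=> A0 Ae Al; elim: s => [|x s IH].
  rewrite (_ : truncation _ _ = vzero)//; apply/funext => v.
  by rewrite /truncation /mul_fun mul0r.
(* A repetition in the list must not count twice. *)
have [xs|xs] := boolP (x \in s).
  rewrite (_ : truncation _ _ = truncation s f)//; apply/funext => v.
  by rewrite /truncation /mul_fun inE; case: eqP => // ->; rewrite xs.
rewrite (_ : truncation _ _ = lincomb (f x) (ebasis x) (truncation s f)); first exact: Al.
apply/funext => v; rewrite /truncation /mul_fun /lincomb /ebasis inE.
case: eqP => [->|_] /=; last by rewrite mulr0 add0r.
by rewrite (negbTE xs) mul1r mul0r addr0 mulr1.
Qed.

Lemma normc2_rest s f v :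
  nrm (rest s f v) ^+ 2 = if v \in s then 0 else nrm (f v) ^+ 2.
Proof.
by rewrite normc2_mul_fun; case: ifP => _ /=; rewrite ?expr0n ?expr1n ?mul0r ?mul1r.
Qed.

(** With a weight, one truncation can serve f and its image under a shift. *)
Lemma rest_small (w : V -> \bar R) f (e : R) :
  (forall v, (0 <= w v)%E) ->
  (\esum_(v in setT) (w v * (nrm (f v) ^+ 2)%:E) < +oo)%E -> 0 < e ->
  exists s, (\esum_(v in setT) (w v * (nrm (rest s f v) ^+ 2)%:E) < e%:E)%E.
Proof.
move=> w0 woo e0.
have x0 v : (0 <= w v * (nrm (f v) ^+ 2)%:E)%E by rewrite mule_ge0// lee_fin normc2_ge0.
have [F /finite_seqP[s ->] tail] := esum_tail x0 woo e0.
exists s; rewrite (le_lt_trans _ tail)// [leRHS]esum_mkcond; apply: le_esum => v _.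
rewrite normc2_rest; case: ifPn => vs.
  by rewrite mule0; case: ifP.
by rewrite mem_set//=; exact/negP.
Qed.

End FiniteSupport.

Lemma le_small_eq0 {R : realType} (x K : R) : 0 <= x -> 0 <= K ->
  (forall d, 0 < d -> x <= K * d) -> x = 0.
Proof.
move=> x0 K0 xK; apply/eqP; rewrite eq_le x0 andbT leNgt; apply/negP => xp.
have K1 : 0 < K + 1 by lra.
have := xK (x / (K + 1)) (divr_gt0 xp K1).
rewrite leNgt => /negP; apply; rewrite mulrA ltr_pdivrMr//; nra.
Qed.

(** * The polar decomposition of a weighted shift *)

Section PolarDecomposition.
Context {R : realType} {V : choiceType}.
Variable E : rel V.
Variable lam : V -> R[i].
Hypothesis treeE : directed_tree E.
Hypothesis dense_lam : densely_defined (wshift E lam).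
Implicit Types (f g h : V -> R[i]).

Local Notation S := (wshift E lam).

Definition shift_abs (u : V) : R := norm2 (wshift_fun E lam (ebasis u)).
Local Notation a := shift_abs.

Lemma shift_abs_ge0 u : 0 <= a u. Proof. exact: norm2_ge0. Qed.

Lemma wshift_abs f : sqsum (wshift_fun E lam f) = sqsum (mul_fun a f).
Proof. by apply: wshift_norm => // u; exact: ell2_wshift_ebasis. Qed.

Lemma wshift_abs_eq0 f : wshift_fun E lam f = vzero <-> mul_fun a f = vzero.
Proof.
split=> f0; apply: sqsum_eq0.
  by rewrite -wshift_abs f0 sqsum_vzero.
by rewrite wshift_abs f0 sqsum_vzero.
Qed.

Lemma inner_wshift f g : ell2 (mul_fun a f) -> ell2 (mul_fun a g) ->
  inner (wshift_fun E lam f) (wshift_fun E lam g) = inner (mul_fun a f) (mul_fun a g).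
Proof.
move=> f2 g2; rewrite !polarization//; last first.
all: rewrite /ell2 /= ?wshift_abs//.
congr (_ * _); apply: eq_bigr => k _.
by rewrite -wshift_fun_lincomb -mul_fun_lincomb wshift_abs.
Qed.

(** Since <S f', S f> = <a f', a f>, testing against e_u gives
(S*S f)(u) = a(u)^2 f(u). Conversely, if a^2 f is in l^2 then so is a f. *)
Lemma adjoint_wshift_comp : Defs.comp (adjoint S) S = diag (fun u => a u ^+ 2).
Proof.
apply/seteqP; split => -[f h]; rewrite /Defs.comp /diag /=.
- move=> [g /(wshiftP treeE)[f2 g2 gE] [_ /= h2 adj]]; split=> //; apply/funext => u.
  have af2 : ell2 (mul_fun a f) by rewrite /ell2 /= -wshift_abs -gE.
  have e2 := @ell2_ebasis R V u; have ae2 := ell2_mul_ebasis a u.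
  have Se : S (ebasis u, wshift_fun E lam (ebasis u)).
    by apply/wshiftP => //; split => //; rewrite /ell2 /= wshift_abs.
  have := adj _ _ Se; rewrite gE inner_wshift// (innerC af2 ae2) (innerC h2 e2).
  move=> /(can_inj (@conjCK _)).
  by rewrite -inner_mul_fun !inner_ebasis /mul_fun => <-; rewrite mulrA -rmorphM.
- move=> [f2 h2 hE]; have af2 : ell2 (mul_fun a f).
    by apply: ell2_mul_sqr; rewrite // -hE.
  exists (wshift_fun E lam f).
    by apply/wshiftP => //; split=> //; rewrite /ell2/= wshift_abs.
  split=> //=; first by rewrite /ell2/= wshift_abs.
  move=> f' k /(wshiftP treeE)[f2' k2 kE]; rewrite kE inner_wshift//.
    by rewrite inner_mul_fun mul_fun_mul hE.
  by rewrite /ell2 /= -wshift_abs -kE.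
Qed.

Lemma op_abs_wshift : op_abs S = diag a.
Proof.
have [v0] := tree_nonempty treeE.
rewrite /op_abs adjoint_wshift_comp (op_pow_diag v0); last by move=> v; exact: sqr_ge0.
congr diag; apply/funext => v.
by rewrite powR12_sqrt ?sqr_ge0// sqrtr_sqr ger0_norm ?shift_abs_ge0.
Qed.

Lemma op_pow_abs_wshift s : op_pow (op_abs S) s = diag (fun u => a u `^ s).
Proof.
have [v0] := tree_nonempty treeE.
by rewrite op_abs_wshift (op_pow_diag v0)//; exact: shift_abs_ge0.
Qed.

(** The partial isometry U of the polar decomposition: U e_u = S e_u / |S e_u|,
or 0 when S e_u = 0 (the inverse of 0 being 0). *)
Definition polar_fun f := wshift_fun E lam (mul_fun (fun u => (a u)^-1) f).

Definition polar_op : op R V := [set fg | ell2 fg.1 /\ fg.2 = polar_fun fg.1].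

(** The factor a(u) / a(u) is 1, or 0 where a vanishes. *)
Lemma sqsum_polar_fun f :
  sqsum (polar_fun f) = sqsum (mul_fun (fun u => a u / a u) f).
Proof. by rewrite /polar_fun wshift_abs mul_fun_mul. Qed.

Lemma sqsum_polar_fun_le f : (sqsum (polar_fun f) <= sqsum f)%E.
Proof.
rewrite sqsum_polar_fun -[leRHS]mul1e; apply: sqsum_le => // v.
rewrite normc2_mul_fun ler_wpM2r ?normc2_ge0//.
by have [->|a0] := eqVneq (a v) 0; rewrite ?mul0r ?expr0n// divff// expr1n.
Qed.

Lemma ell2_polar_fun f : ell2 f -> ell2 (polar_fun f).
Proof. by apply: le_lt_trans; exact: sqsum_polar_fun_le. Qed.

Lemma polar_fun_lincomb c f g :
  polar_fun (lincomb c f g) = lincomb c (polar_fun f) (polar_fun g).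
Proof. by rewrite /polar_fun mul_fun_lincomb wshift_fun_lincomb. Qed.

Lemma polar_fun0 : polar_fun vzero = vzero.
Proof.
rewrite /polar_fun; apply/wshift_abs_eq0; apply/funext => v.
by rewrite /mul_fun /vzero !mulr0.
Qed.

Lemma polar_fun_eq0 f : polar_fun f = vzero <-> mul_fun a f = vzero.
Proof.
rewrite /polar_fun wshift_abs_eq0; split => f0; apply/funext => v;
  have := congr1 (@^~ v) f0; rewrite /mul_fun /vzero; move/eqP.
  have [->|a0] := eqVneq (a v) 0; rewrite ?mul0r//.
  by rewrite mulrA -rmorphM divff// mul1r => /eqP ->; rewrite mulr0.
rewrite mulf_eq0 => /orP[|] /eqP; last by move=> ->; rewrite !mulr0.
by move=> ->; rewrite mul0r.
Qed.

(** Where a vanishes the inverse is lost, but there the weights vanish as well. *)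
Lemma polar_fun_abs f : polar_fun (mul_fun a f) = wshift_fun E lam f.
Proof.
apply/funext => v; rewrite /polar_fun /wshift_fun; case: ifPn => // /set_mem [u Euv].
rewrite (par_eq treeE Euv) /mul_fun.
have [a0|a0] := eqVneq (a u) 0.
  rewrite (wshift_weight_eq0 treeE a0 _ Euv) ?mul0r//.
  exact: ell2_wshift_ebasis.
by rewrite [X in _ * X]mulrA -rmorphM mulVf// mul1r.
Qed.

Lemma norm2_le f g : ell2 g -> (sqsum f <= sqsum g)%E -> norm2 f <= norm2 g.
Proof.
move=> g2 fg; rewrite /norm2 ler_wsqrtr// fine_le// ?sqsum_fin_num//.
exact: le_lt_trans fg g2.
Qed.

(** The kernel contains every e_u with a(u) = 0, so the vectors orthogonal to it
live where a(u) / a(u) = 1. *)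
Lemma polar_op_isometry : partial_isometry polar_op.
Proof.
split.
- split.
  + by move=> f g [/= f2 ->]; split=> //; exact: ell2_polar_fun.
  + by split; [exact: ell2_vzero|rewrite /= polar_fun0].
  + move=> c f g f' g' [/= f2 ->] [/= f2' ->].
    by split; [exact: ell2_lincomb|rewrite /= polar_fun_lincomb].
  + by move=> f g g' [_ /= ->] [_ /= ->].
- apply/seteqP; split=> [f [g []//]|f f2].
  by exists (polar_fun f).
- exists 1 => f g [/= f2 ->]; rewrite mul1r; apply: norm2_le => //.
  exact: sqsum_polar_fun_le.
- move=> f g [f2 orth] [/= _ ->]; rewrite /norm2 sqsum_polar_fun.
  congr (Num.sqrt (fine (sqsum _))).
  apply/funext => u; rewrite /mul_fun; have [a0|a0] := eqVneq (a u) 0; last first.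
    by rewrite divff// mul1r.
  suff -> : f u = 0 by rewrite mulr0.
  rewrite -inner_ebasis; apply: orth; split; first exact: ell2_ebasis.
  apply/esym/polar_fun_eq0; rewrite mul_fun_ebasis a0.
  by apply/funext => v; rewrite mul0r.
Qed.

Lemma polar_opP : polar_factor S polar_op.
Proof.
split; first exact: polar_op_isometry.
- apply/seteqP; split=> f; rewrite /Defs.kernel /polar_op /=.
    move=> [f2 /esym/polar_fun_eq0/wshift_abs_eq0 f0]; apply/wshiftP => //.
    by split=> //; exact: ell2_vzero.
  move=> /(wshiftP treeE)[f2 _ /esym/wshift_abs_eq0 f0]; split=> //.
  by apply/esym/polar_fun_eq0.
- rewrite op_abs_wshift; apply/seteqP; split=> -[f g].
    move=> /(wshiftP treeE)[f2 g2 gE].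
    have af2 : ell2 (mul_fun a f) by rewrite /ell2 /= -wshift_abs -gE.
    by exists (mul_fun a f); [split|split => //=; rewrite polar_fun_abs].
  move=> [h [/= f2 h2 ->]] [/= af2 ->]; apply/wshiftP => //; rewrite polar_fun_abs.
  by split=> //; rewrite /ell2 /= wshift_abs.
Qed.

End PolarDecomposition.

Section PolarUnique.
Context {R : realType} {V : choiceType}.
Variable E : rel V.
Variable lam : V -> R[i].
Hypothesis treeE : directed_tree E.
Hypothesis dense_lam : densely_defined (wshift E lam).
Implicit Types (f g h : V -> R[i]).

Local Notation S := (wshift E lam).
Local Notation a := (shift_abs E lam).

Lemma lincomb0r c f : lincomb c f vzero = fun v => c * f v.
Proof. by apply/funext => v; rewrite /lincomb /vzero addr0. Qed.

Lemma scale_ebasis_inv (c : R) u : c != 0 ->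
  lincomb ((c^-1)%:C) (mul_fun (fun=> c) (@ebasis R V u)) vzero = ebasis u.
Proof.
move=> c0; rewrite lincomb0r; apply/funext => v.
by rewrite /mul_fun mulrA -rmorphM mulVf// mul1r.
Qed.

(** A polar factor agrees with the explicit one on the basis, hence on finitely
supported vectors, hence everywhere by boundedness. *)
Lemma polar_factor_unique U f g : polar_factor S U -> U (f, g) ->
  ell2 f /\ g = polar_fun E lam f.
Proof.
move=> [[[Ull U0 Ulin Ufun] Udom [c Uc] _] Uker SU] Ufg.
have [f2 g2] := Ull _ _ Ufg; split=> //.
have Ue u : U (ebasis u, polar_fun E lam (ebasis u)).
  have e2 := @ell2_ebasis R V u; have ae2 := ell2_mul_ebasis a u.
  have Se : S (ebasis u, wshift_fun E lam (ebasis u)).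
    by apply/wshiftP => //; split => //; rewrite /ell2 /= wshift_abs.
  have [a0|a0] := eqVneq (a u) 0.
    have ae0 : mul_fun a (@ebasis R V u) = vzero.
      by rewrite mul_fun_ebasis a0; apply/funext => v; rewrite mul0r.
    rewrite (polar_fun_eq0 treeE dense_lam _).2//.
    have : Defs.kernel S (@ebasis R V u).
      by rewrite /Defs.kernel /= -((wshift_abs_eq0 treeE dense_lam _).2 ae0).
    by rewrite -Uker.
  have [h] : Defs.comp U (op_abs S) (ebasis u, wshift_fun E lam (ebasis u)).
    by rewrite -SU.
  rewrite op_abs_wshift// => -[/= _ h2 hE] Uh.
  have aE : h = mul_fun (fun=> a u) (ebasis u) by rewrite hE mul_fun_ebasis.
  have := Ulin ((a u)^-1)%:C _ _ _ _ Uh U0.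
  rewrite {1}aE scale_ebasis_inv//; congr (U (_, _)).
  rewrite -(polar_fun_abs treeE dense_lam) -hE aE.
  rewrite -[X in lincomb _ _ X](polar_fun0 treeE dense_lam) -polar_fun_lincomb.
  by rewrite scale_ebasis_inv.
have Ur s : U (truncation s f, polar_fun E lam (truncation s f)).
  apply: (@truncation_ind _ _ [set f | U (f, polar_fun E lam f)]) => //=.
    by rewrite polar_fun0.
  by move=> d h h' Uh Uh'; rewrite polar_fun_lincomb; exact: Ulin.
apply/funext => v; apply/eqP; rewrite -subr_eq0; apply/eqP; apply: normc2_eq0.
(* At v, the operators U and polar_fun differ on f by what they do to the rest
   of a truncation, where they have norms at most c and 1. *)
apply: (@le_small_eq0 _ _ (2 * (c ^+ 2 + 1))); rewrite ?normc2_ge0//.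
  by rewrite mulr_ge0// addr_ge0// sqr_ge0.
move=> d d0.
have w0 (w : V) : (0 <= 1 :> \bar R)%E by [].
have f2' : (\esum_(v in setT) (1 * (nrm (f v) ^+ 2)%:E) < +oo)%E.
  by under eq_esum do rewrite mul1e.
have [s] := rest_small w0 f2' d0.
under eq_esum do rewrite mul1e.
rewrite -/(sqsum _) => small.
have r2 : ell2 (rest s f) by apply: lt_trans small _; rewrite ltry.
have := Ulin (-1) _ _ _ _ (Ur s) Ufg; rewrite sub_truncation.
set k := lincomb _ _ _ => Uk; have [_ k2] := Ull _ _ Uk.
have -> : g v - polar_fun E lam f v = k v + (- polar_fun E lam (rest s f) v).
  rewrite -sub_truncation polar_fun_lincomb /k /lincomb; ring.
apply: (le_trans (normc2D _ _)); rewrite -mulrA ler_pM2l// mulrDl mul1r.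
have smallR : norm2 (rest s f) ^+ 2 <= d.
  by rewrite norm2_sqr -lee_fin fine_sqsumK// ltW.
have sqle (x y : R) : 0 <= x -> x <= y -> x ^+ 2 <= y ^+ 2.
  by move=> x0 xy; rewrite lerXn2r ?nnegrE// (le_trans x0).
apply: lerD.
  apply: (@le_trans _ _ ((c * norm2 (rest s f)) ^+ 2)).
    by apply: sqle; [exact: normc_ge0|exact: le_trans (normc_le_norm2 v k2) (Uc _ _ Uk)].
  by rewrite exprMn ler_wpM2l// sqr_ge0.
rewrite normc2N; apply: le_trans smallR.
apply: sqle; first exact: normc_ge0.
apply: le_trans (normc_le_norm2 v _) _; first exact: ell2_polar_fun.
by apply: norm2_le => //; exact: sqsum_polar_fun_le.
Qed.

(** * The Aluthge transform *)

Lemma VplusP u : u \in Vplus E lam <-> a u != 0.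
Proof.
have e2 := ell2_wshift_ebasis treeE u dense_lam.
rewrite inE /Vplus /= /shift_abs; split.
  move=> Se; apply/eqP => a0; apply: Se; apply: sqsum_eq0.
  by rewrite -fine_sqsumK// -norm2_sqr a0 expr0n.
move=> /eqP a0 Se; apply: a0; rewrite Se /norm2.
by rewrite sqsum_vzero sqrtr0.
Qed.

Variable t : R.
Local Notation mu := (aluthge_weights E t lam).

(** At the parent u of v one has a(u)^(1 - t) / a(u) = a(u)^(-t); both sides
vanish when a(u) = 0. *)
Lemma aluthge_fun f :
  mul_fun (fun u => a u `^ t) (polar_fun E lam (mul_fun (fun u => a u `^ (1 - t)) f)) =
  wshift_fun E mu f.
Proof.
apply/funext => v; rewrite /polar_fun /wshift_fun {1}/mul_fun.
case: ifPn => [/set_mem [u Euv]|_]; last by rewrite mulr0.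
rewrite /aluthge_weights (par_eq treeE Euv) -!/(a _) /mul_fun.
have [au0|au0] := eqVneq (a u) 0.
  have /negP/negbTE -> : ~ u \in Vplus E lam by move=> /VplusP; rewrite au0 eqxx.
  by rewrite au0 invr0 !mul0r mulr0 mulr0.
have -> : u \in Vplus E lam by apply/VplusP.
rewrite -!/(a _).
have pt0 : a u `^ t != 0 by rewrite powR_eq0 negb_and au0.
have -> : a u `^ (1 - t) = a u / a u `^ t.
  apply: (mulIf pt0); rewrite -powRD ?au0 ?implybT// divfK//.
  by rewrite subrK powRr1 ?shift_abs_ge0.
have E1 : ((a u)^-1)%:C * (a u / a u `^ t)%:C = ((a u `^ t)^-1)%:C :> R[i].
  by rewrite -rmorphM mulrA mulVf// mul1r.
rewrite [X in _ * (_ * X)]mulrA E1.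
by rewrite rmorphM -!mulrA; congr (_ * _); rewrite mulrCA.
Qed.

Lemma aluthgeP f g : aluthge t S (f, g) <->
  [/\ ell2 f, ell2 (mul_fun (fun u => a u `^ (1 - t)) f), ell2 g
    & g = wshift_fun E mu f].
Proof.
rewrite /aluthge /= /Defs.comp /= !op_pow_abs_wshift//; split.
  move=> [U polU [g1 [k [/= f2 k2 kE] Uk] [/= g12 g2 gE]]].
  have [_ g1E] := polar_factor_unique polU Uk.
  by split=> //; rewrite ?gE ?g1E ?kE ?aluthge_fun// -kE.
move=> [f2 k2 g2 gE]; exists (polar_op E lam); first exact: polar_opP.
exists (polar_fun E lam (mul_fun (fun u => a u `^ (1 - t)) f)).
  by exists (mul_fun (fun u => a u `^ (1 - t)) f).
by split=> //=; [exact: ell2_polar_fun|rewrite aluthge_fun].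
Qed.

End PolarUnique.

(** * Closures of restrictions of weighted shifts *)

Section Closure.
Context {R : realType} {V : choiceType}.
Variable E : rel V.
Hypothesis treeE : directed_tree E.
Implicit Types (f g : V -> R[i]) (mu : V -> R[i]) (c : V -> R).

(** Convergence in l^2 implies convergence at v and at its parent. *)
Lemma wshift_closed mu f g : closure_op (wshift E mu) (f, g) -> wshift E mu (f, g).
Proof.
move=> [/= f2 g2 appr]; apply/wshiftP => //; split=> //; apply/funext => v.
apply/eqP; rewrite -subr_eq0; apply/eqP; apply: normc2_eq0.
(* The error at v comes from g' at v and from f' at the parent of v. *)
apply: (@le_small_eq0 _ _ (2 * (1 + nrm (mu v) ^+ 2))); rewrite ?normc2_ge0//.
  by rewrite mulr_ge0// addr_ge0// normc2_ge0.
move=> d d0; have sd0 : 0 < Num.sqrt d by rewrite sqrtr_gt0.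
have [[f' g'] [/= /(wshiftP treeE)[f2' g2' gE'] ff' gg']] := appr _ sd0.
have close h h' w : ell2 h -> ell2 h' -> norm2 (lincomb (-1) h' h) < Num.sqrt d ->
    nrm (lincomb (-1) h' h w) ^+ 2 <= d.
  move=> h2 h2' /ltW hh'; rewrite -[leRHS](sqr_sqrtr (ltW d0)).
  rewrite (@ler_pXn2r _ 2) ?nnegrE ?normc_ge0 ?sqrtr_ge0//.
  by apply: le_trans (normc_le_norm2 w _) hh'; exact: ell2_lincomb.
have -> : g v - wshift_fun E mu f v =
    lincomb (-1) g' g v + - wshift_fun E mu (lincomb (-1) f' f) v.
  by rewrite gE' wshift_fun_lincomb /lincomb; ring.
apply: (le_trans (normc2D _ _)); rewrite -mulrA ler_pM2l// mulrDl mul1r.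
apply: lerD; first exact: close.
rewrite normc2N /wshift_fun; case: ifP => _.
  by rewrite normc2M ler_wpM2l ?normc2_ge0// close.
by rewrite (normc2_real 0) expr0n mulr_ge0 ?normc2_ge0// ltW.
Qed.

(** Weighting by 1 + w gives the squared graph norm, so that a single truncation
approximates f and its image; finite support puts it in every diagonal domain. *)
Lemma wshift_core mu c f : wshift_dom E mu f -> forall e : R, 0 < e ->
  exists f', [/\ wshift E mu (f', wshift_fun E mu f'), ell2 (mul_fun c f'),
    norm2 (lincomb (-1) f' f) < e
  & norm2 (lincomb (-1) (wshift_fun E mu f') (wshift_fun E mu f)) < e].
Proof.
move=> [f2 muf] e e0.
pose w u := (\esum_(v in chi E u) (nrm (mu v) ^+ 2)%:E)%E.
have w0 u : (0 <= w u)%E by apply: esum_ge0 => v _; rewrite lee_fin normc2_ge0.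
have wD u (x : R) : 0 <= x -> ((1 + w u) * x%:E = x%:E + w u * x%:E)%E.
  by move=> x0; rewrite ge0_muleDl// mul1e.
have w10 u : (0 <= 1 + w u)%E by rewrite adde_ge0.
have foo : (\esum_(u in setT) ((1 + w u) * (nrm (f u) ^+ 2)%:E) < +oo)%E.
  under eq_esum do rewrite wD ?normc2_ge0//.
  rewrite esumD; last 2 first.
  - by move=> u _; rewrite lee_fin normc2_ge0.
  - by move=> u _; rewrite mule_ge0// lee_fin normc2_ge0.
  exact: lte_add_pinfty.
have [s small] := rest_small w10 foo (exprn_gt0 2 e0).
exists (truncation s f).
have r2 : ell2 (truncation s f).
  apply: ell2_mul_le => // v; by case: (_ \in _); rewrite ?normr1 ?normr0.
split.
- apply/wshiftP => //; split=> //; rewrite /ell2 /= sqsum_wshift//.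
  apply: le_esum_lty muf => u _; apply: lee_wpmul2l; first exact: w0.
  rewrite lee_fin /truncation normc2_mul_fun.
  case: (_ \in _); rewrite ?expr1n ?mul1r//.
  by rewrite expr0n mul0r normc2_ge0.
- apply: (@truncation_ind _ _ [set g | ell2 (mul_fun c g)]) => /=.
  + rewrite (_ : mul_fun _ _ = vzero); first exact: ell2_vzero.
    by apply/funext => v; rewrite /mul_fun /vzero mulr0.
  + by move=> u; exact: ell2_mul_ebasis.
  + by move=> d g h g2 h2; rewrite mul_fun_lincomb; exact: ell2_lincomb.
- rewrite sub_truncation; apply: norm2_lt => //; apply: le_lt_trans small.
  apply: le_esum => u _; rewrite wD ?normc2_ge0// leeDl//.
  by rewrite mule_ge0// lee_fin normc2_ge0.
- rewrite -wshift_fun_lincomb sub_truncation; apply: norm2_lt => //.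
  apply: le_lt_trans small; rewrite sqsum_wshift//.
  by apply: le_esum => u _; rewrite wD ?normc2_ge0// leeDr// lee_fin normc2_ge0.
Qed.

(** The truncations provided by [wshift_core] lie in the domain of T. *)
Lemma closure_wshift_restriction mu c (T : op R V) :
  (forall f g, T (f, g) <-> wshift E mu (f, g) /\ ell2 (mul_fun c f)) ->
  closure_op T = wshift E mu.
Proof.
move=> TE; apply/seteqP; split=> -[f g].
  move=> [f2 g2 appr]; apply: wshift_closed; split=> // e /appr[[f' g'] [Tfg ? ?]].
  by exists (f', g'); split=> //; exact: ((TE _ _).1 Tfg).1.
move=> Wfg; have [f2 g2 gE] := (wshiftP treeE _ _ _).1 Wfg.
split=> //= e e0; have [f' [Wf' cf' ff' gg']] := wshift_core c Wfg.1 e0.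
by exists (f', wshift_fun E mu f'); rewrite /= gE; split=> //; apply/TE.
Qed.

End Closure.

Theorem theorem4p1 (R : realType) (V : choiceType) (E : rel V)
    (lam : V -> R[i]) (t : R) (treeE : directed_tree E)
    (dense_lam : densely_defined (wshift E lam))
    (t_gt0 : 0 < t) (t_le1 : t <= 1) :
  let S := wshift E lam in
  let mu := aluthge_weights E t lam in
  dom (aluthge t S) = dom (wshift E mu) `&` dom (op_pow (op_abs S) (1 - t))
  /\ (closable (aluthge t S) /\ closure_op (aluthge t S) = wshift E mu).
Proof.
move=> S mu.
have TE f g : aluthge t S (f, g) <-> wshift E mu (f, g) /\
    ell2 (mul_fun (fun u => shift_abs E lam u `^ (1 - t)) f).
  rewrite aluthgeP// wshiftP//; split; first by move=> [].
  by move=> [[f2 g2 gE] cf]; split.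
have cl := closure_wshift_restriction treeE TE; split; last first.
  by rewrite /closable cl; split=> //; exact: wshift_linear.
rewrite op_pow_abs_wshift//; apply/seteqP; split=> f.
  move=> [g /TE[Wfg cf]]; split; first by exists g.
  exists (mul_fun (fun u => shift_abs E lam u `^ (1 - t)) f).
  by have [f2 _ _] := (wshiftP treeE _ _ _).1 Wfg.
by move=> [[g Wfg] [h [/= f2 h2 hE]]]; exists g; apply/TE; rewrite -hE.
Qed.
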